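(* Let $A\subseteq\omega^\omega$ be a (lightface) $\Sigma^1_1$ set. Then one and only one of the following two claims holds: (I) $A$ is $\Delta^1_3$-effectively $\sigma$-compact, that is, there exists a $\Delta^1_3$ sequence $\langle T^n\rangle_{n<\omega}$ of compact $\Delta^1_3$ trees $T^n\subseteq\omega^{<\omega}$ such that $A=\bigcup_{n<\omega}[T^n]$; (II) there is a set $Y\subseteq A$ homeomorphic to $\omega^\omega$ and relatively closed in $A$.
   Context: $\omega^\omega$ is the Baire space, and $\omega^{<\omega}$ is the set of all finite strings of natural numbers. A set $T\subseteq\omega^{<\omega}$ is a tree if $u\in T$ whenever $u^\frown n\in T$ for at least one $n$. A tree is pruned if $u\in T$ implies $u^\frown n\in T$ for at least one $n$. A tree is compact if it is pruned and for each $u\in T$ there are only finitely many $n$ with $u^\frown n\in T$. The body of $T$ is $[T]=\{x\in\omega^\omega:\forall m\,(x\restriction m\in T)\}$. *)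

(* Defs.v *)
From HB Require Import structures.
From mathcomp Require Import all_boot all_classical topology.

Set Implicit Arguments.
Unset Strict Implicit.
Unset Printing Implicit Defensive.

Local Open Scope classical_set_scope.

Definition baire : Type := prod_topology (fun _ : nat => nat).

HB.instance Definition _ := Pointed.on baire.
HB.instance Definition _ := Nbhs.on baire.
HB.instance Definition _ := Topological.on baire.
HB.instance Definition _ := Uniform.on baire.

(* Second-order arithmetic with number variables and function variables
   (ranging over [baire]), both as de Bruijn indices, each sort having its own
   index space. There are no parameters, so the resulting definability classes
   are lightface. *)
Inductive term : Type :=
| tVar of nat
| tZero
| tSucc of term
| tAdd of term & term
| tMul of term & term
| tApp of nat & term. (* [tApp i t]: function variable [i] applied to [t] *)

Inductive formula : Type :=
| fEq of term & term
| fLt of term & term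
| fNot of formula
| fAnd of formula & formula
| fOr of formula & formula
| fAllN of formula
| fExN of formula
| fAllF of formula
| fExF of formula.

(* Indices beyond the environment denote the number 0 and the zero function,
   both definable, so formulas with stray variables add no definable sets. *)
Fixpoint term_val (e : seq nat) (F : seq baire) (t : term) : nat :=
  match t with
  | tVar i => nth 0 e i
  | tZero => 0
  | tSucc t => (term_val e F t).+1
  | tAdd s t => term_val e F s + term_val e F t
  | tMul s t => term_val e F s * term_val e F t
  | tApp i t => nth (fun=> 0) F i (term_val e F t)
  end.

Fixpoint sat (e : seq nat) (F : seq baire) (phi : formula) : Prop :=
  match phi with
  | fEq s t => term_val e F s = term_val e F t
  | fLt s t => term_val e F s < term_val e F t
  | fNot p => ~ sat e F p
  | fAnd p q => sat e F p /\ sat e F q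
  | fOr p q => sat e F p \/ sat e F q
  | fAllN p => forall n, sat (n :: e) F p
  | fExN p => exists n, sat (n :: e) F p
  | fAllF p => forall x, sat e (x :: F) p
  | fExF p => exists x, sat e (x :: F) p
  end.

Fixpoint arithmetical (phi : formula) : bool :=
  match phi with
  | fEq _ _ | fLt _ _ => true
  | fNot p | fAllN p | fExN p => arithmetical p
  | fAnd p q | fOr p q => arithmetical p && arithmetical q
  | fAllF _ | fExF _ => false
  end.

(* Sigma^1_n and Pi^1_n formulas: alternating blocks of function quantifiers
   in front of an arithmetical matrix. *)
Inductive Sigma1 : nat -> formula -> Prop :=
| Sigma1_arith p : arithmetical p -> Sigma1 0 p
| Sigma1_Pi1 n p : Pi1 n p -> Sigma1 n.+1 p
| Sigma1_ex n p : Sigma1 n.+1 p -> Sigma1 n.+1 (fExF p)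
with Pi1 : nat -> formula -> Prop :=
| Pi1_arith p : arithmetical p -> Pi1 0 p
| Pi1_Sigma1 n p : Sigma1 n p -> Pi1 n.+1 p
| Pi1_all n p : Pi1 n.+1 p -> Pi1 n.+1 (fAllF p).

Definition lightface_Sigma1 (k : nat) (A : set baire) : Prop :=
  exists2 p, Sigma1 k p & A = [set x | sat [::] [:: x] p].

(* Finite strings enter formulas through the recursive bijection
   [CodeSeq.code] between [seq nat] and [nat]. *)
Definition lightface_Delta1_strings (k : nat) (S : set (seq nat)) : Prop :=
  (exists2 p, Sigma1 k p & S = [set u | sat [:: CodeSeq.code u] [::] p]) /\
  (exists2 p, Pi1 k p & S = [set u | sat [:: CodeSeq.code u] [::] p]).

(* A sequence of sets of strings, as the subset {(n, u) : u \in T n} of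
   omega x omega^{<omega}. *)
Definition lightface_Delta1_seq (k : nat) (T : nat -> set (seq nat)) : Prop :=
  (exists2 p, Sigma1 k p &
     forall n, T n = [set u | sat [:: n; CodeSeq.code u] [::] p]) /\
  (exists2 p, Pi1 k p &
     forall n, T n = [set u | sat [:: n; CodeSeq.code u] [::] p]).

Definition tree (T : set (seq nat)) : Prop :=
  forall u, (exists n, T (rcons u n)) -> T u.

Definition pruned (T : set (seq nat)) : Prop :=
  forall u, T u -> exists n, T (rcons u n).

Definition compact_tree (T : set (seq nat)) : Prop :=
  [/\ tree T, pruned T &
      forall u, T u -> finite_set [set n | T (rcons u n)]].

Definition body (T : set (seq nat)) : set baire :=
  [set x | forall m, T (mkseq x m)].

Definition effectively_sigma_compact_Delta1 (k : nat) (A : set baire) : Prop :=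
  exists T : nat -> set (seq nat),
    [/\ lightface_Delta1_seq k T,
        forall n, compact_tree (T n) /\ lightface_Delta1_strings k (T n) &
        A = \bigcup_n body (T n)].

Definition homeomorphic_to_baire (Y : set baire) : Prop :=
  exists f g : baire -> baire,
    [/\ continuous f, {within Y, continuous g}, cancel f g & range f = Y].

Definition relatively_closed (A Y : set baire) : Prop :=
  exists2 C : set baire, closed C & Y = A `&` C.

(* Main.v *)
Require Import Defs.
From mathcomp Require Import all_boot all_classical topology zify.

(** A Sigma^1_1 set has a normal form A = f[C] with C an arithmetical closed
    subset of the Baire space and f a coordinate projection: Skolem functions
    absorb the number quantifiers of the matrix
    ([lightface_Sigma11_closed_image]). The dichotomy comes from a
    Cantor-Bendixson style derivation on C.

    Given a set I of basic neighbourhoods that have already been discarded,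
    the next step discards the neighbourhoods N for which f[(C \ I) n N] has a
    compact closure contained in A ([derivative]). Iterating transfinitely, and
    taking unions at limits, yields an increasing tower of sets.

    If a point of C survives, the surviving set F is closed, and on every
    neighbourhood N meeting F the image f[F n N] is either unbounded or
    accumulates at a point outside A. Either way F n N contains points y_n
    whose images lie in disjoint cylinders that cluster at no point of A
    ([splitting]). Repeating this along a tree of neighbourhoods gives a
    homeomorphic copy of the Baire space, closed in A ([closed_copy]).

    If nothing survives, A is the union over t of the compact closures of
    f[(C \ I_t) n N_t], where I_t consists of what was discarded strictly
    before N_t ([sigma_compact_decomposition]). The complexity bound rests on
    the fact that the prewellordering of the neighbourhoods by stage is the
    only real R that is a wellfounded linear preorder and satisfies, for all s
    and t,
        s <=_R t  iff  s <_R t or s is discarded next after {r | r <_R t}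
    ([tower_rel_unique]). Membership in the derivative is built by Boolean
    operations and number quantifiers from Pi^1_2 conditions, the hardest being
    that a closed set is contained in A, so this characterisation of R is
    Delta^1_3. As R exists and is unique, membership of a string in the tree of
    the t-th compact set can be expressed both as: some R with this property
    puts it there, and as: all do ([Dl_derived_tree]).

    The alternatives are incompatible because the Baire space is not
    sigma-compact: a closed copy of it inside a union of countably many compact
    sets would make it a countable union of compact, hence pointwise bounded,
    sets, against a diagonal argument ([sigma_compact_no_closed_copy]). *)

Local Open Scope classical_set_scope.
Set Implicit Arguments.
Unset Strict Implicit.
Unset Printing Implicit Defensive.

(** * Substitution in second-order formulas *)

Definition scons (T : Type) (x : T) (f : nat -> T) : nat -> T :=
  fun i => if i is j.+1 then f j else x.
Notation "x .: f" := (scons x f) (at level 55, right associativity).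

Lemma comp_scons (S T : Type) (h : S -> T) x f :
  (fun i => h ((x .: f) i)) = h x .: (fun i => h (f i)).
Proof. by apply: funext => -[]. Qed.

Definition assignment : Type := nat -> baire.

Fixpoint tval (e : nat -> nat) (F : assignment) (t : term) : nat :=
  match t with
  | tVar i => e i
  | tZero => 0
  | tSucc t => (tval e F t).+1
  | tAdd s t => tval e F s + tval e F t
  | tMul s t => tval e F s * tval e F t
  | tApp i t => F i (tval e F t)
  end.

(** Total environments make substitution a plain composition; [satE] relates
    them to the finite environments of [sat]. *)
Fixpoint holds (e : nat -> nat) (F : assignment) (p : formula) : Prop :=
  match p with
  | fEq s t => tval e F s = tval e F t
  | fLt s t => tval e F s < tval e F t
  | fNot p => ~ holds e F p
  | fAnd p q => holds e F p /\ holds e F q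
  | fOr p q => holds e F p \/ holds e F q
  | fAllN p => forall n, holds (n .: e) F p
  | fExN p => exists n, holds (n .: e) F p
  | fAllF p => forall x, holds e (x .: F) p
  | fExF p => exists x, holds e (x .: F) p
  end.

Definition num_env (s : seq nat) : nat -> nat := nth 0 s.
Definition fun_env (s : seq baire) : assignment := nth (fun=> 0 : nat) s.

Lemma term_valE e F t : term_val e F t = tval (num_env e) (fun_env F) t.
Proof. by elim: t => //= [t ->|s -> t ->|s -> t ->|i t ->]. Qed.

Lemma num_env_cons n e : num_env (n :: e) = n .: num_env e.
Proof. by apply: funext => -[]. Qed.

Lemma fun_env_cons x F : fun_env (x :: F) = x .: fun_env F.
Proof. by apply: funext => -[]. Qed.

Lemma satE e F p : sat e F p <-> holds (num_env e) (fun_env F) p.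
Proof.
elim: p e F => [s t|s t|p IH|p IHp q IHq|p IHp q IHq|p IH|p IH|p IH|p IH] e F /=.
- by rewrite !term_valE.
- by rewrite !term_valE.
- by rewrite IH.
- by rewrite IHp IHq.
- by rewrite IHp IHq.
- by split=> h n; have := h n; rewrite IH num_env_cons.
- by split=> -[n h]; exists n; move: h; rewrite IH num_env_cons.
- by split=> h n; have := h n; rewrite IH fun_env_cons.
- by split=> -[n h]; exists n; move: h; rewrite IH fun_env_cons.
Qed.

Fixpoint tsubN (r : nat -> term) (t : term) : term :=
  match t with
  | tVar i => r i
  | tZero => tZero
  | tSucc t => tSucc (tsubN r t)
  | tAdd s t => tAdd (tsubN r s) (tsubN r t)
  | tMul s t => tMul (tsubN r s) (tsubN r t)
  | tApp i t => tApp i (tsubN r t)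
  end.

Lemma tval_subN e F r t :
  tval e F (tsubN r t) = tval (fun i => tval e F (r i)) F t.
Proof. by elim: t => //= [t ->|s -> t ->|s -> t ->|i t ->]. Qed.

Fixpoint tshiftF (t : term) : term :=
  match t with
  | tVar i => tVar i
  | tZero => tZero
  | tSucc t => tSucc (tshiftF t)
  | tAdd s t => tAdd (tshiftF s) (tshiftF t)
  | tMul s t => tMul (tshiftF s) (tshiftF t)
  | tApp i t => tApp i.+1 (tshiftF t)
  end.

Lemma tval_shiftF e x F t : tval e (x .: F) (tshiftF t) = tval e F t.
Proof. by elim: t => //= [t ->|s -> t ->|s -> t ->|i t ->]. Qed.

(** A function variable is replaced by an abstraction: [T i] is a term in which
    number variable 0 stands for the argument, the others being shifted. *)
Fixpoint tsub (S T : nat -> term) (t : term) : term :=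
  match t with
  | tVar i => S i
  | tZero => tZero
  | tSucc t => tSucc (tsub S T t)
  | tAdd s t => tAdd (tsub S T s) (tsub S T t)
  | tMul s t => tMul (tsub S T s) (tsub S T t)
  | tApp i t => tsubN (tsub S T t .: tVar) (T i)
  end.

Lemma tval_sub e F S T t :
  tval e F (tsub S T t) =
  tval (fun i => tval e F (S i)) (fun i k => tval (k .: e) F (T i)) t.
Proof.
elim: t => //= [t ->|s -> t ->|s -> t ->|i t IH] //.
by rewrite tval_subN comp_scons IH.
Qed.

Definition liftN (S : nat -> term) : nat -> term :=
  tVar 0 .: (fun i => tsubN (fun j => tVar j.+1) (S i)).
Definition abs_liftN (T : nat -> term) : nat -> term :=
  fun i => tsubN (tVar 0 .: (fun j => tVar j.+2)) (T i).
Definition liftF (S : nat -> term) : nat -> term := fun i => tshiftF (S i).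
Definition abs_liftF (T : nat -> term) : nat -> term :=
  tApp 0 (tVar 0) .: (fun i => tshiftF (T i)).

Fixpoint fsub (S T : nat -> term) (p : formula) : formula :=
  match p with
  | fEq s t => fEq (tsub S T s) (tsub S T t)
  | fLt s t => fLt (tsub S T s) (tsub S T t)
  | fNot p => fNot (fsub S T p)
  | fAnd p q => fAnd (fsub S T p) (fsub S T q)
  | fOr p q => fOr (fsub S T p) (fsub S T q)
  | fAllN p => fAllN (fsub (liftN S) (abs_liftN T) p)
  | fExN p => fExN (fsub (liftN S) (abs_liftN T) p)
  | fAllF p => fAllF (fsub (liftF S) (abs_liftF T) p)
  | fExF p => fExF (fsub (liftF S) (abs_liftF T) p)
  end.

Lemma arithmetical_sub S T p : arithmetical (fsub S T p) = arithmetical p.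
Proof. by elim: p S T => //= p IHp q IHq S T; rewrite IHp IHq. Qed.

Lemma holds_sub e F S T p :
  holds e F (fsub S T p) <->
  holds (fun i => tval e F (S i)) (fun i k => tval (k .: e) F (T i)) p.
Proof.
have liftNE e' F' S' n : (fun i => tval (n .: e') F' (liftN S' i)) =
    n .: (fun i => tval e' F' (S' i)).
  by apply: funext => -[//|i] /=; rewrite tval_subN.
have abs_liftNE e' F' T' n :
    (fun i k => tval (k .: n .: e') F' (abs_liftN T' i)) =
    (fun i k => tval (k .: e') F' (T' i)).
  apply: funext => i; apply: funext => k; rewrite tval_subN; congr tval.
  by apply: funext => -[].
have liftFE e' F' S' x : (fun i => tval e' (x .: F') (liftF S' i)) =
    (fun i => tval e' F' (S' i)).
  by apply: funext => i; rewrite tval_shiftF.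
have abs_liftFE e' F' T' x :
    (fun i k => tval (k .: e') (x .: F') (abs_liftF T' i)) =
    x .: (fun i k => tval (k .: e') F' (T' i)).
  by apply: funext => -[//|i] /=; apply: funext => k; rewrite tval_shiftF.
elim: p e F S T => [s t|s t|p IH|p IHp q IHq|p IHp q IHq|p IH|p IH|p IH|p IH]
  e F S T /=.
- by rewrite !tval_sub.
- by rewrite !tval_sub.
- by rewrite IH.
- by rewrite IHp IHq.
- by rewrite IHp IHq.
- by split=> h n; have := h n; rewrite IH liftNE abs_liftNE.
- by split=> -[n h]; exists n; move: h; rewrite IH liftNE abs_liftNE.
- by split=> h n; have := h n; rewrite IH liftFE abs_liftFE.
- by split=> -[n h]; exists n; move: h; rewrite IH liftFE abs_liftFE.
Qed.

(** * Coding sequences of functions *)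

(** A polynomial, so that the coding is expressed by a term of the language;
    injectivity is all that coding needs. *)
Definition npair (n k : nat) : nat := (n + k) * (n + k) + n.

Lemma npair_inj n k n' k' : npair n k = npair n' k' -> n = n' /\ k = k'.
Proof.
rewrite /npair => h.
have h1 : n + k = n' + k'.
  (* The code lies between the squares of [n + k] and [n + k + 1]. *)
  by case: (ltngtP (n + k) (n' + k')) => //; nia.
by move: h; rewrite h1; lia.
Qed.

Definition slice (n : nat) (z : baire) : baire := fun k => z (npair n k).

(** This contracts blocks of function quantifiers and, by choosing all the
    [y n] at once, moves number quantifiers inside function quantifiers. *)
Lemma slice_surj (y : nat -> baire) : exists z, forall n, slice n z = y n.
Proof.
have [z hz] : exists z : baire, forall c n k, c = npair n k -> z c = y n k.
  suff /choice[z hz] : forall c, exists v, forall n k, c = npair n k -> v = y n k.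
    by exists z.
  move=> c; case: (pselect (exists nk, c = npair nk.1 nk.2)) => [[[n k] /= ->]|h].
    by exists (y n k) => n' k' /npair_inj[-> ->].
  by exists 0 => n k E; case: h; exists (n, k).
by exists z => n; apply: funext => k; rewrite /slice (hz _ n k).
Qed.

(** * Definable predicates *)

Definition predicate : Type := (nat -> nat) -> assignment -> Prop.

Definition term_definable (g : (nat -> nat) -> assignment -> nat) : Prop :=
  exists t, forall e F, tval e F t = g e F.

(** The argument of the function is number variable 0, as in [tsub]. *)
Definition fun_definable (h : (nat -> nat) -> assignment -> baire) : Prop :=
  term_definable (fun e F => h (fun i => e i.+1) F (e 0)).

Lemma td_var i : term_definable (fun e _ => e i).
Proof. by exists (tVar i). Qed.
Lemma td_const n : term_definable (fun _ _ => n).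
Proof. by exists (iter n tSucc tZero) => e F; elim: n => //= n ->. Qed.
Lemma td_succ g : term_definable g -> term_definable (fun e F => (g e F).+1).
Proof. by case=> t ht; exists (tSucc t) => e F /=; rewrite ht. Qed.
Lemma td_add g h : term_definable g -> term_definable h ->
  term_definable (fun e F => g e F + h e F).
Proof. by case=> t ht [s hs]; exists (tAdd t s) => e F /=; rewrite ht hs. Qed.
Lemma td_mul g h : term_definable g -> term_definable h ->
  term_definable (fun e F => g e F * h e F).
Proof. by case=> t ht [s hs]; exists (tMul t s) => e F /=; rewrite ht hs. Qed.
Lemma td_app i g : term_definable g -> term_definable (fun e F => F i (g e F)).
Proof. by case=> t ht; exists (tApp i t) => e F /=; rewrite ht. Qed.
Lemma fd_lam h : term_definable (fun e F => h (fun i => e i.+1) F (e 0)) ->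
  fun_definable h.
Proof. by []. Qed.

Lemma td_slice n g i : term_definable n -> term_definable g ->
  term_definable (fun e F => slice (n e F) (F i) (g e F)).
Proof.
move=> hn hg; have hs := td_add hn hg.
exact: (td_app i (td_add (td_mul hs hs) hn)).
Qed.

Ltac td := repeat (cbv beta; first
  [ match goal with |- fun_definable _ => apply: fd_lam end
  | apply: td_var | apply: td_const | apply: td_succ | apply: td_add
  | apply: td_mul | apply: td_app | apply: td_slice | assumption ]).

Definition arith (P : predicate) : Prop :=
  exists2 p, arithmetical p & forall e F, holds e F p <-> P e F.

(** The Sigma^1_n predicates. Blocks of like quantifiers contract to a single
    one by [slice_surj], and Pi^1_m appears as the complement of [Sg m], so
    that one recursion suffices. *)
Fixpoint Sg (n : nat) (P : predicate) : Prop :=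
  if n is m.+1 then
    exists2 Q, Sg m Q & forall e F, P e F <-> exists y, ~ Q e (y .: F)
  else arith P.

Lemma eq_Sg n P Q : (forall e F, P e F <-> Q e F) -> Sg n P -> Sg n Q.
Proof.
move=> PQ; have -> // : P = Q.
by apply: funext => e; apply: funext => F; apply/propext.
Qed.

Lemma term_definable_shift g : term_definable g ->
  term_definable (fun e F => g e (fun i => F i.+1)).
Proof.
case=> t ht; exists (tshiftF t) => e F; rewrite -ht.
have -> : F = F 0 .: (fun i => F i.+1) by apply: funext => -[].
by rewrite tval_shiftF.
Qed.

Lemma fun_definable_shift h : fun_definable h ->
  fun_definable (fun e F => h e (fun i => F i.+1)).
Proof. exact: (@term_definable_shift (fun e F => h (fun i => e i.+1) F (e 0))). Qed.

Lemma Sg_sub n P (s : (nat -> nat) -> assignment -> nat -> nat)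
    (t : (nat -> nat) -> assignment -> assignment) :
  (forall i, term_definable (fun e F => s e F i)) ->
  (forall i, fun_definable (fun e F => t e F i)) ->
  Sg n P -> Sg n (fun e F => P (s e F) (t e F)).
Proof.
elim: n P s t => [|n IH] P s t hs ht /=.
  case=> p ap hp; have [S hS] := choice hs; have [T hT] := choice ht.
  exists (fsub S T p); first by rewrite arithmetical_sub.
  move=> e F; rewrite holds_sub hp.
  have -> : (fun i => tval e F (S i)) = s e F by apply: funext => i; rewrite hS.
  have -> // : (fun i k => tval (k .: e) F (T i)) = t e F.
  by apply: funext => i; apply: funext => k; rewrite hT.
case=> Q hQ PQ.
exists (fun e F => Q (s e (fun i => F i.+1)) (F 0 .: t e (fun i => F i.+1))).
  apply: IH => // [i|[|i]] /=; first exact: term_definable_shift (hs i).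
    by td.
  exact: fun_definable_shift (ht i).
by move=> e F; rewrite PQ.
Qed.

Lemma arith_not P : arith P -> arith (fun e F => ~ P e F).
Proof. by case=> p ap hp; exists (fNot p) => // e F; rewrite /= hp. Qed.

Lemma Sg_shift n P : Sg n P -> Sg n (fun e F => P e (fun i => F i.+1)).
Proof.
by apply: (Sg_sub (s := fun e F => e) (t := fun e F i => F i.+1)) => i; td.
Qed.

(** Conjunction and disjunction need each other: [Sg n.+1] is built on negated
    matrices, which exchanges them. *)
Lemma Sg_andor n P Q : Sg n P -> Sg n Q ->
  Sg n (fun e F => P e F /\ Q e F) /\ Sg n (fun e F => P e F \/ Q e F).
Proof.
elim: n P Q => [|n IH] P Q /=.
  case=> p ap hp [q aq hq]; split.
    by exists (fAnd p q) => [/=|e F /=]; rewrite ?ap ?aq ?hp ?hq.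
  by exists (fOr p q) => [/=|e F /=]; rewrite ?ap ?aq ?hp ?hq.
case=> P' hP' PE [Q' hQ' QE]; split.
  pose t c : (nat -> nat) -> assignment -> assignment :=
    fun e F => slice c (F 0) .: (fun i => F i.+1).
  have ht c i : fun_definable (fun e F => t c e F i).
    by rewrite /t; case: i => [|i] /=; td.
  have hs i : term_definable (fun e _ => e i) by td.
  have [_ h] := IH _ _ (Sg_sub hs (ht 0) hP') (Sg_sub hs (ht 1) hQ').
  eexists; first exact: h.
  move=> e F; rewrite PE QE; split=> [[[y Py] [y' Qy']]|[z /not_orP[Pz Qz]]].
    have [z hz] := slice_surj (y .: (fun=> y')).
    by exists z; rewrite /t /= !hz /=; case.
  by split; eexists; eassumption.
have [h _] := IH _ _ hP' hQ'.
eexists; first exact: h.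
move=> e F; rewrite PE QE; split=> [[[y Py]|[y Qy]]|[z /not_andP[Pz|Qz]]].
- by exists y; case.
- by exists y; case.
- by left; exists z.
- by right; exists z.
Qed.

Lemma Sg_and n P Q : Sg n P -> Sg n Q -> Sg n (fun e F => P e F /\ Q e F).
Proof. by move=> hP hQ; have [] := Sg_andor hP hQ. Qed.

Lemma Sg_or n P Q : Sg n P -> Sg n Q -> Sg n (fun e F => P e F \/ Q e F).
Proof. by move=> hP hQ; have [] := Sg_andor hP hQ. Qed.

(** A universal number quantifier passes an existential function quantifier by
    choosing all witnesses at once and coding them as one function. *)
Lemma Sg_quantN n P : Sg n P ->
  Sg n (fun e F => forall k, P (k .: e) F) /\
  Sg n (fun e F => exists k, P (k .: e) F).
Proof.
elim: n P => [|n IH] P /=.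
  case=> p ap hp; split.
    by exists (fAllN p) => //= e F; split=> h k; apply/hp/h.
  by exists (fExN p) => //= e F; split=> -[k h]; exists k; apply/hp.
case=> Q hQ PE; split; last first.
  have [h _] := IH _ hQ.
  eexists; first exact: h.
  move=> e F; split=> [[k /PE[y Qy]]|[y /existsNP[k Qk]]].
    by exists y => /(_ k).
  by exists k; apply/PE; exists y.
pose t : (nat -> nat) -> assignment -> assignment :=
  fun e F => slice (e 0) (F 0) .: (fun i => F i.+1).
have ht i : fun_definable (fun e F => t e F i).
  by rewrite /t; case: i => [|i] /=; td.
have hs i : term_definable (fun e _ => e i) by td.
have [_ h] := IH _ (Sg_sub hs ht hQ).
eexists; first exact: h.
move=> e F; split=> [Pk|[z /forallNP Qz k]].
  have {Pk} /choice[y hy] : forall k, exists y, ~ Q (k .: e) (y .: F).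
    by move=> k; apply/PE/Pk.
  have [z hz] := slice_surj y.
  by exists z => -[k]; rewrite /t /= hz; apply: hy.
by apply/PE; eexists; exact: Qz.
Qed.

Lemma Sg_exN n Q : Sg n (fun e F => Q (fun i => e i.+1) F (e 0)) ->
  Sg n (fun e F => exists k, Q e F k).
Proof. by move=> /Sg_quantN[_ h]; exact: h. Qed.

Lemma Sg_allN n Q : Sg n (fun e F => Q (fun i => e i.+1) F (e 0)) ->
  Sg n (fun e F => forall k, Q e F k).
Proof. by move=> /Sg_quantN[h _]; exact: h. Qed.

Lemma Sg_not n P : Sg n P -> Sg n.+1 (fun e F => ~ P e F).
Proof.
move=> hP; exists (fun e F => P e (fun i => F i.+1)); first exact: Sg_shift.
by move=> e F; split=> [h|[y //]]; exists (fun=> 0).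
Qed.

Lemma SgS n P : Sg n P -> Sg n.+1 P.
Proof.
elim: n P => [|n IH] P; last by case=> Q hQ PE; exists Q => //; exact: IH.
move=> hP; apply: eq_Sg (@Sg_not 0 _ (arith_not hP)) => e F /=.
by split=> [/contrapT|h].
Qed.

Lemma Sg_le m n P : m <= n -> Sg m P -> Sg n P.
Proof.
by move=> /subnK <-; elim: (n - m) => [//|k IH] hP; apply/SgS/IH.
Qed.

Lemma Sg_exF n Q : Sg n.+1 (fun e F => Q e (fun i => F i.+1) (F 0)) ->
  Sg n.+1 (fun e F => exists y, Q e F y).
Proof.
case=> R hR QE.
pose t : (nat -> nat) -> assignment -> assignment :=
  fun e F => slice 1 (F 0) .: (slice 0 (F 0) .: (fun i => F i.+1)).
have ht i : fun_definable (fun e F => t e F i).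
  by rewrite /t; case: i => [|[|i]] /=; td.
have hs i : term_definable (fun e _ => e i) by td.
exists (fun e F => R e (t e F)); first exact: Sg_sub hs ht hR.
move=> e F; split=> [[y /(QE e (y .: F))[y' h]]|[z h]].
  have [z hz] := slice_surj (y .: (fun=> y')).
  by exists z; rewrite /t /= !hz.
by exists (slice 0 z); apply/(QE e (slice 0 z .: F)); exists (slice 1 z).
Qed.

(** Both halves are proved together because each quantifier switches between a
    predicate and its complement. *)
Lemma Sigma1_Sg n P : Sg n P ->
  (exists2 p, Sigma1 n p & forall e F, holds e F p <-> P e F) /\
  (exists2 p, Pi1 n p & forall e F, holds e F p <-> ~ P e F).
Proof.
elim: n P => [|n IH] P /=.
  case=> p ap hp; split; first by exists p => //; constructor.
  by exists (fNot p) => [|e F /=]; [constructor|rewrite hp].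
case=> Q /IH[[q Sq hq] [r Pr hr]] PE; split.
  exists (fExF r); first by do 2 constructor.
  by move=> e F /=; rewrite PE; split=> -[y h]; exists y; apply/hr.
exists (fAllF q); first by do 2 constructor.
move=> e F /=; rewrite PE; split=> [h [y]|/forallNP h y]; first by case; apply/hq.
by apply/hq; apply: contrapT; apply: h.
Qed.

Lemma Sg_Sigma1 p : Sigma1 1 p -> Sg 1 (fun e F => holds e F p).
Proof.
suff h n q : Sigma1 n q -> n = 1 -> Sg 1 (fun e F => holds e F q) by move=> /h; apply.
elim=> // {}n {}q.
  move=> + [n0]; rewrite n0 => hr; apply: SgS; 
  by exists q => //; inversion hr.
move=> hq IH E; apply: Sg_exF; apply: eq_Sg (IH E) => e F.
by have <- : F 0 .: (fun i => F i.+1) = F by apply: funext => -[].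
Qed.

(** The Delta^1_n predicates. *)
Definition Dl (n : nat) (P : predicate) : Prop :=
  Sg n P /\ Sg n (fun e F => ~ P e F).

Lemma eq_Dl n P Q : (forall e F, P e F <-> Q e F) -> Dl n P -> Dl n Q.
Proof.
move=> PQ; have -> // : P = Q.
by apply: funext => e; apply: funext => F; apply/propext.
Qed.

Lemma Dl_Sg n P : Sg n P -> Dl n.+1 P.
Proof. by move=> h; split; [exact: SgS|exact: Sg_not]. Qed.

Lemma Dl_le m n P : m <= n -> Dl m P -> Dl n P.
Proof. by move=> mn [h1 h2]; split; apply: Sg_le mn _. Qed.

Lemma Dl_not n P : Dl n P -> Dl n (fun e F => ~ P e F).
Proof.
move=> [h1 h2]; split=> //; apply: eq_Sg h1 => e F.
by split=> [h|/contrapT].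
Qed.

Lemma Dl_or n P Q : Dl n P -> Dl n Q -> Dl n (fun e F => P e F \/ Q e F).
Proof.
move=> [h1 h2] [h3 h4]; split; first exact: Sg_or.
by apply: eq_Sg (Sg_and h2 h4) => e F; rewrite not_orE.
Qed.

Lemma Dl_and n P Q : Dl n P -> Dl n Q -> Dl n (fun e F => P e F /\ Q e F).
Proof.
move=> [h1 h2] [h3 h4]; split; first exact: Sg_and.
by apply: eq_Sg (Sg_or h2 h4) => e F; rewrite not_andE.
Qed.

Lemma Dl_imp n P Q : Dl n P -> Dl n Q -> Dl n (fun e F => P e F -> Q e F).
Proof.
move=> hP hQ; apply: eq_Dl (Dl_or (Dl_not hP) hQ) => e F.
by split=> [[]|h] //; case: (pselect (P e F)) => [/h|]; [right|left].
Qed.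

Lemma Dl_exN n Q : Dl n (fun e F => Q (fun i => e i.+1) F (e 0)) ->
  Dl n (fun e F => exists k, Q e F k).
Proof.
move=> [h1 h2]; split; first exact: Sg_exN.
apply: (@eq_Sg _ (fun e F => forall k, ~ Q e F k)); last exact: Sg_allN.
by move=> e F; split=> [/forallNP//|h]; apply/forallNP.
Qed.

Lemma Dl_allN n Q : Dl n (fun e F => Q (fun i => e i.+1) F (e 0)) ->
  Dl n (fun e F => forall k, Q e F k).
Proof.
move=> [h1 h2]; split; first exact: Sg_allN.
apply: (@eq_Sg _ (fun e F => exists k, ~ Q e F k)); last exact: Sg_exN.
by move=> e F; split=> [/existsNP//|h]; apply/existsNP.
Qed.

Lemma Dl_arith n P : arith P -> Dl n P.
Proof.
by move=> h; apply: (Dl_le (leq0n n)); split=> //; exact: arith_not.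
Qed.

Lemma Dl_eq n g h : term_definable g -> term_definable h ->
  Dl n (fun e F => g e F = h e F).
Proof.
move=> [s hs] [t ht]; apply: Dl_arith; exists (fEq s t) => // e F /=.
by rewrite hs ht.
Qed.

Lemma Dl_lt n g h : term_definable g -> term_definable h ->
  Dl n (fun e F => g e F < h e F).
Proof.
move=> [s hs] [t ht]; apply: Dl_arith; exists (fLt s t) => // e F /=.
by rewrite hs ht.
Qed.

(** Sigma^1_n.+1 and Pi^1_n.+1 are both included in Delta^1_n.+2, so a function
    quantifier of either kind costs one level. *)
Lemma Dl_exF n Q : Dl n.+1 (fun e F => Q e (fun i => F i.+1) (F 0)) ->
  Dl n.+2 (fun e F => exists y, Q e F y).
Proof. by move=> [h _]; apply/Dl_Sg/Sg_exF. Qed.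

Lemma Dl_allF n Q : Dl n.+1 (fun e F => Q e (fun i => F i.+1) (F 0)) ->
  Dl n.+2 (fun e F => forall y, Q e F y).
Proof.
move=> /Dl_not h; have := Dl_not (Dl_exF (Q := fun e F y => ~ Q e F y) h).
apply: eq_Dl => e F.
by split=> [/forallNP h' y|h' [y]]; [apply: contrapT; apply: h'|].
Qed.

Lemma Dl_sub n P (s : (nat -> nat) -> assignment -> nat -> nat)
    (t : (nat -> nat) -> assignment -> assignment) :
  (forall i, term_definable (fun e F => s e F i)) ->
  (forall i, fun_definable (fun e F => t e F i)) ->
  Dl n P -> Dl n (fun e F => P (s e F) (t e F)).
Proof.
move=> hs ht [h1 h2].
by split; [exact: (Sg_sub hs ht h1)|exact: (Sg_sub hs ht h2)].
Qed.

(** * Arithmetical predicates as projections of closed ones *)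

Definition agree (m : nat) (x y : baire) : Prop := forall i, i < m -> x i = y i.

Definition env_agree m (e e' : nat -> nat) (F F' : assignment) : Prop :=
  (forall i, i < m -> e i = e' i) /\ (forall i, i < m -> agree m (F i) (F' i)).

Lemma env_agree_le m n e e' F F' : m <= n ->
  env_agree n e e' F F' -> env_agree m e e' F F'.
Proof.
move=> mn [h1 h2]; split=> i im; first by apply: h1; exact: leq_trans mn.
by move=> k km; apply: h2; exact: leq_trans mn.
Qed.

(** The evaluation of a term inspects finitely many values: terms are
    continuous, which yields all the topology of definable predicates. *)
Lemma tval_local e F t : exists m, forall e' F',
  env_agree m e e' F F' -> tval e F t = tval e' F' t.
Proof.
elim: t => [i||t [m IH]|s [m IHs] t [n IHt]|s [m IHs] t [n IHt]|i t [m IH]].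
- by exists i.+1 => e' F' [h _]; exact: h.
- by exists 0.
- by exists m => e' F' /IH /= ->.
- exists (maxn m n) => e' F' h /=.
  by congr (_ + _); [apply: IHs|apply: IHt]; apply: env_agree_le h; lia.
- exists (maxn m n) => e' F' h /=.
  by congr (_ * _); [apply: IHs|apply: IHt]; apply: env_agree_le h; lia.
exists (maxn m (i + tval e F t).+1) => e' F' h /=.
rewrite -(IH e' F'); last by apply: env_agree_le h; lia.
by case: h => _ h; apply: h; lia.
Qed.

Lemma uniform_bound (P : nat -> nat -> Prop) :
  (forall i m n, m <= n -> P i m -> P i n) -> (forall i, exists m, P i m) ->
  forall k, exists m, forall i, i < k -> P i m.
Proof.
move=> mono ex; elim=> [|k [m IH]]; first by exists 0.
have [n Pn] := ex k; exists (maxn m n) => i; rewrite ltnS leq_eqVlt => /predU1P[->|ik].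
  by apply: mono Pn; lia.
by apply: mono (IH _ ik); lia.
Qed.

(** Closedness in the product of the spaces of both sorts of variables; number
    variables are included so that the matrices under number quantifiers can be
    handled too. *)
Definition closed_pred (P : predicate) : Prop := forall e F,
  (forall m, exists e' F', env_agree m e e' F F' /\ P e' F') -> P e F.

Lemma closed_pred_sub P (s : (nat -> nat) -> assignment -> nat -> nat)
    (t : (nat -> nat) -> assignment -> assignment) :
  (forall i, term_definable (fun e F => s e F i)) ->
  (forall i, fun_definable (fun e F => t e F i)) ->
  closed_pred P -> closed_pred (fun e F => P (s e F) (t e F)).
Proof.
move=> hs ht cP e F apx; apply: cP => m.
have [m1 hm1] : exists m1, forall i, i < m -> forall e' F',
    env_agree m1 e e' F F' -> s e F i = s e' F' i.
  apply: (@uniform_bound (fun i m1 => forall e' F',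
    env_agree m1 e e' F F' -> s e F i = s e' F' i)) => [i a b ab h e' F' h'|i].
    by apply: h; exact: env_agree_le h'.
  have [u hu] := hs i; have [a ha] := tval_local e F u.
  by exists a => e' F' h'; rewrite -!hu; exact: ha.
have [m2 hm2] : exists m2, forall i, i < m -> forall k, k < m -> forall e' F',
    env_agree m2 e e' F F' -> t e F i k = t e' F' i k.
  apply: (@uniform_bound (fun i m2 => forall k, k < m -> forall e' F',
    env_agree m2 e e' F F' -> t e F i k = t e' F' i k))
    => [i a b ab h k km e' F' h'|i].
    by apply: h => //; exact: env_agree_le h'.
  apply: (@uniform_bound (fun k m2 => forall e' F',
    env_agree m2 e e' F F' -> t e F i k = t e' F' i k))
    => [k a b ab h e' F' h'|k].
    by apply: h; exact: env_agree_le h'.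
  have [u hu] := ht i; have [a ha] := tval_local (k .: e) F u.
  exists a => e' F' [h1 h2]; have := ha (k .: e') F'; rewrite !hu /=; apply.
  by split=> // -[//|j] ja /=; apply: h1; lia.
have [e' [F' [h P']]] := apx (maxn m1 m2).
exists (s e' F'), (t e' F'); split=> //; split=> i im.
  by apply: hm1 => //; apply: env_agree_le h; lia.
by move=> k km; apply: hm2 => //; apply: env_agree_le h; lia.
Qed.

Lemma closed_predU P Q : closed_pred P -> closed_pred Q ->
  closed_pred (fun e F => P e F \/ Q e F).
Proof.
move=> cP cQ e F apx; apply: contrapT => /not_orP[nP nQ].
have /existsNP[m hm] := contra_not (cP e F) nP.
have /existsNP[n hn] := contra_not (cQ e F) nQ.
have [e' [F' [h [h'|h']]]] := apx (maxn m n).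
  by apply: hm; exists e', F'; split=> //; apply: env_agree_le h; lia.
by apply: hn; exists e', F'; split=> //; apply: env_agree_le h; lia.
Qed.

(** Sigma^1_1 predicates presented with a closed matrix. *)
Definition proj_closed (P : predicate) : Prop :=
  exists Q, [/\ arith Q, closed_pred Q &
    forall e F, P e F <-> exists z, Q e (z .: F)].

Lemma eq_proj_closed P Q : (forall e F, P e F <-> Q e F) ->
  proj_closed P -> proj_closed Q.
Proof.
move=> PQ; have -> // : P = Q.
by apply: funext => e; apply: funext => F; apply/propext.
Qed.

Lemma proj_closed_local P : arith P ->
  (forall e F, exists m, forall e' F', env_agree m e e' F F' -> P e' F' -> P e F) ->
  proj_closed P.
Proof.
move=> aP locP; exists (fun e F => P e (fun i => F i.+1)); split.
- exact: (@Sg_shift 0).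
- apply: (closed_pred_sub (s := fun e F => e) (t := fun e F i => F i.+1)).
  + by move=> i; td.
  + by move=> i; td.
  by move=> e F apx; have [m hm] := locP e F; have [e' [F' [/hm]]] := apx m.
- by move=> e F; split=> [h|[]//]; exists (fun=> 0).
Qed.

Lemma proj_closedU P Q : proj_closed P -> proj_closed Q ->
  proj_closed (fun e F => P e F \/ Q e F).
Proof.
move=> [P' [aP cP PE]] [Q' [aQ cQ QE]].
exists (fun e F => P' e F \/ Q' e F); split; first exact: (@Sg_or 0).
  exact: closed_predU.
move=> e F; rewrite PE QE; split=> [[[z h]|[z h]]|[z [h|h]]].
- by exists z; left.
- by exists z; right.
- by left; exists z.
- by right; exists z.
Qed.

Lemma proj_closed_allN P : proj_closed P ->
  proj_closed (fun e F => forall n, P (n .: e) F).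
Proof.
move=> [Q [aQ cQ PE]].
pose t : (nat -> nat) -> assignment -> assignment :=
  fun e F => slice (e 0) (F 0) .: (fun i => F i.+1).
have ht i : fun_definable (fun e F => t e F i).
  by rewrite /t; case: i => [|i] /=; td.
have hs i : term_definable (fun e _ => e i) by td.
have h1 := Sg_quantN (n := 0) (Sg_sub (n := 0) hs ht aQ).
have h2 := closed_pred_sub hs ht cQ.
eexists; split; first exact: h1.1.
  move=> e F apx n; apply: h2 => m; have [e' [F' [h h']]] := apx m.
  exists (n .: e'), F'; split; last exact: h'.
  by case: h => h3 h4; split=> // -[//|j] ja /=; apply: h3; lia.
move=> e F; split=> [Pk|[z Qz k]].
  have {Pk} /choice[y hy] : forall k, exists y, Q (k .: e) (y .: F).
    by move=> k; apply/PE/Pk.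
  have [z hz] := slice_surj y.
  by exists z => k; rewrite /t /= hz; apply: hy.
by apply/PE; eexists; exact: Qz.
Qed.

Lemma proj_closed_exN P : proj_closed P ->
  proj_closed (fun e F => exists n, P (n .: e) F).
Proof.
move=> [Q [aQ cQ PE]].
pose s : (nat -> nat) -> assignment -> nat -> nat := fun e F => F 0 0 .: e.
pose t : (nat -> nat) -> assignment -> assignment :=
  fun e F => (fun k => F 0 k.+1) .: (fun i => F i.+1).
have ht i : fun_definable (fun e F => t e F i).
  by rewrite /t; case: i => [|i] /=; td.
have hs i : term_definable (fun e F => s e F i).
  by rewrite /s; case: i => [|i] /=; td.
exists (fun e F => Q (s e F) (t e F)); split.
- exact: (Sg_sub (n := 0) hs ht aQ).
- exact: closed_pred_sub hs ht cQ.
move=> e F; split=> [[n /PE[z h]]|[z h]]; first by exists (n .: z).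
by exists (z 0); apply/PE; eexists; exact: h.
Qed.

Lemma proj_closedI P Q : proj_closed P -> proj_closed Q ->
  proj_closed (fun e F => P e F /\ Q e F).
Proof.
move=> [P' [aP cP PE]] [Q' [aQ cQ QE]].
pose t c : (nat -> nat) -> assignment -> assignment :=
  fun e F => slice c (F 0) .: (fun i => F i.+1).
have ht c i : fun_definable (fun e F => t c e F i).
  by rewrite /t; case: i => [|i] /=; td.
have hs i : term_definable (fun e _ => e i) by td.
exists (fun e F => P' e (t 0 e F) /\ Q' e (t 1 e F)); split.
- by apply: (@Sg_and 0); [exact: (Sg_sub (n := 0) hs (ht 0) aP)|
    exact: (Sg_sub (n := 0) hs (ht 1) aQ)].
- move=> e F apx; split.
    apply: (closed_pred_sub hs (ht 0) cP) => m.
    by have [e' [F' [h [h' _]]]] := apx m; exists e', F'.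
  apply: (closed_pred_sub hs (ht 1) cQ) => m.
  by have [e' [F' [h [_ h']]]] := apx m; exists e', F'.
move=> e F; rewrite PE QE; split=> [[[y Py] [y' Qy']]|[z [Pz Qz]]].
  have [z hz] := slice_surj (y .: (fun=> y')).
  by exists z; rewrite /t /= !hz.
by split; eexists; eassumption.
Qed.

(** A Skolem function for a universal number quantifier is a sequence of
    witnesses, coded by its slices; for an existential one it is the value at
    0. Both polarities go through the induction at once because negation swaps
    them. *)
Lemma arithmetical_proj_closed p : arithmetical p ->
  proj_closed (fun e F => holds e F p) /\ proj_closed (fun e F => ~ holds e F p).
Proof.
elim: p => //= [s t|s t|p IH|p IHp q IHq|p IHp q IHq|p IH|p IH].
- move=> _; split; apply: proj_closed_local.
  + by exists (fEq s t).
  + move=> e F; have [m hm] := tval_local e F s; have [n hn] := tval_local e F t.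
    exists (maxn m n) => e' F' h; rewrite (hm e' F') ?(hn e' F')//.
      by apply: env_agree_le h; lia.
    by apply: env_agree_le h; lia.
  + by exists (fNot (fEq s t)).
  + move=> e F; have [m hm] := tval_local e F s; have [n hn] := tval_local e F t.
    exists (maxn m n) => e' F' h; rewrite (hm e' F') ?(hn e' F')//.
      by apply: env_agree_le h; lia.
    by apply: env_agree_le h; lia.
- move=> _; split; apply: proj_closed_local.
  + by exists (fLt s t).
  + move=> e F; have [m hm] := tval_local e F s; have [n hn] := tval_local e F t.
    exists (maxn m n) => e' F' h; rewrite (hm e' F') ?(hn e' F')//.
      by apply: env_agree_le h; lia.
    by apply: env_agree_le h; lia.
  + by exists (fNot (fLt s t)).
  + move=> e F; have [m hm] := tval_local e F s; have [n hn] := tval_local e F t.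
    exists (maxn m n) => e' F' h; rewrite (hm e' F') ?(hn e' F')//.
      by apply: env_agree_le h; lia.
    by apply: env_agree_le h; lia.
- move=> /IH[h1 h2]; split=> //; apply: eq_proj_closed h1 => e F.
  by split=> [h|/contrapT].
- case/andP=> /IHp[p1 p2] /IHq[q1 q2]; split; first exact: proj_closedI.
  by apply: eq_proj_closed (proj_closedU p2 q2) => e F; rewrite not_andE.
- case/andP=> /IHp[p1 p2] /IHq[q1 q2]; split; first exact: proj_closedU.
  by apply: eq_proj_closed (proj_closedI p2 q2) => e F; rewrite not_orE.
- move=> /IH[h1 h2]; split; first exact: proj_closed_allN h1.
  apply: eq_proj_closed (proj_closed_exN h2) => e F.
  by split=> [h|/existsNP//]; apply/existsNP.
- move=> /IH[h1 h2]; split; first exact: proj_closed_exN h1.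
  apply: eq_proj_closed (proj_closed_allN h2) => e F.
  by split=> [h|/forallNP//]; apply/forallNP.
Qed.

Lemma Sg1_proj_closed P : Sg 1 P -> proj_closed P.
Proof.
case=> Q [q aq hq] PE.
have [_ [R [aR cR hR]]] := arithmetical_proj_closed aq.
pose t : (nat -> nat) -> assignment -> assignment :=
  fun e F => slice 1 (F 0) .: (slice 0 (F 0) .: (fun i => F i.+1)).
have ht i : fun_definable (fun e F => t e F i).
  by rewrite /t; case: i => [|[|i]] /=; td.
have hs i : term_definable (fun e _ => e i) by td.
exists (fun e F => R e (t e F)); split.
- exact: (Sg_sub (n := 0) hs ht aR).
- exact: closed_pred_sub hs ht cR.
move=> e F; rewrite PE; split=> [[y]|[z h]].
  rewrite -hq => /hR[y' h].
  have [z hz] := slice_surj (y .: (fun=> y')).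
  by exists z; rewrite /t /= !hz.
by exists (slice 0 z); rewrite -hq; apply/hR; exists (slice 1 z).
Qed.

(** * The tower of a monotone operator *)

(** The stages of the transfinite iteration of [I |-> I `|` D I], described
    without ordinals. *)
Inductive tower (T : Type) (D : set T -> set T) : set T -> Prop :=
| tower_next I : tower D I -> tower D (I `|` D I)
| tower_sup (S : set (set T)) : (forall I, S I -> tower D I) ->
    tower D (\bigcup_(I in S) I).

(** The stages are linearly ordered, and there is nothing strictly between a
    stage and its successor. *)
Lemma tower_linear (T : Type) (D : set T -> set T) (I J : set T) :
  tower D I -> tower D J -> I `<=` J \/ J `|` D J `<=` I.
Proof.
(* The Bourbaki-Witt argument: a set is extreme if the successors of the tower
   sets properly below it are still below it. *)
pose extreme (J : set T) := forall I, tower D I -> I `<=` J -> I <> J ->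
  I `|` D I `<=` J.
have lin J' : tower D J' -> extreme J' -> forall I', tower D I' ->
    I' `<=` J' \/ J' `|` D J' `<=` I'.
  move=> tJ exJ I'; elim=> {I'} [I' tI [IJ|JI]|S hS IH].
  - case: (pselect (I' = J')) => [->|IJ']; first by right.
    by left; exact: exJ.
  - by right; apply: subset_trans JI _; exact: subsetUl.
  case: (pselect (exists2 I', S I' & J' `|` D J' `<=` I')) => [[I' SI JI]|h].
    by right; apply: subset_trans JI _ => x Ix; exists I'.
  left=> x [I' SI Ix]; have [/(_ _ Ix)//|JI] := IH _ SI.
  by case: h; exists I'.
move=> tI tJ; apply: (lin J tJ) => // {I tI}.
elim: tJ => {J} [J tJ exJ|S hS IH] I tI IJ neq.
  have [IJ'|JI] := lin J tJ exJ _ tI; last by case: neq; apply/seteqP.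
  case: (pselect (I = J)) => [->//|IJ''].
  by apply: subset_trans (exJ _ tI IJ' IJ'') _; exact: subsetUl.
case: (pselect (exists2 K, S K & ~ K `<=` I)) => [[K SK KI]|h]; last first.
  case: neq; apply/seteqP; split=> // x [K SK Kx].
  by apply: contrapT => Ix; apply: h; exists K => // /(_ _ Kx).
have [IK|KI'] := lin K (hS _ SK) (IH _ SK) _ tI; last first.
  by case: KI; apply: subset_trans KI'; exact: subsetUl.
have IK' : I <> K by move=> IK'; apply: KI; rewrite IK'.
by move=> x /(IH _ SK _ tI IK IK') Kx; exists K.
Qed.

Section TowerOrder.
Variables (T : Type) (D : set T -> set T).
Hypothesis D_mono : forall I J, I `<=` J -> D I `<=` D J.

Definition kernel : set T := \bigcup_(I in tower D) I.

Lemma tower_kernel : tower D kernel.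
Proof. exact: tower_sup. Qed.

Lemma kernel_closed : D kernel `<=` kernel.
Proof.
move=> x Dx; exists (kernel `|` D kernel); last by right.
exact: tower_next tower_kernel.
Qed.

(** The prewellordering of the kernel by stage of appearance. *)
Definition tower_le (s t : T) : Prop := forall I, tower D I -> I t -> I s.

(** By [stageE] and [stageN], the last stage at which [t] has not appeared. *)
Definition stage (t : T) : set T := [set s | ~ tower_le t s].

Lemma stageE t : stage t = \bigcup_(I in [set I | tower D I /\ ~ I t]) I.
Proof.
apply/seteqP; split=> [s /existsNP[I /not_implyP[tI /not_implyP[Is It]]]|].
  by exists I.
by move=> s [I [tI It] Is] h; apply: It; exact: h.
Qed.

Lemma tower_stage t : tower D (stage t).
Proof. by rewrite stageE; apply: tower_sup => I []. Qed.

Lemma stageN t : ~ stage t t.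
Proof. by rewrite stageE => -[I []]. Qed.

Lemma tower_le_total s t : tower_le s t \/ tower_le t s.
Proof.
apply: contrapT => /not_orP[].
move=> /existsNP[I /not_implyP[tI /not_implyP[It nIs]]].
move=> /existsNP[J /not_implyP[tJ /not_implyP[Js nJt]]].
by have [IJ|/(_ s (or_introl Js))//] := tower_linear tI tJ; exact/nJt/IJ.
Qed.

Lemma tower_le_trans s t u : tower_le s t -> tower_le t u -> tower_le s u.
Proof. by move=> st tu I tI Iu; apply: st => //; exact: tu. Qed.

Lemma tower_subset_stage I t : tower D I -> ~ I t -> I `<=` stage t.
Proof. by move=> tI It x Ix; rewrite stageE; exists I. Qed.

(** If [t] did not enter right after [stage t], that stage would be a fixed point
    of the iteration, and [t] would never appear. *)
Lemma stage_next t : kernel t -> (stage t `|` D (stage t)) t.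
Proof.
move=> [I0 tI0 I0t]; apply: contrapT => /not_orP[_ nt].
have fix_stage : D (stage t) `<=` stage t.
  move=> x Dx; apply: (tower_subset_stage (tower_next (tower_stage t))).
    by case; [exact: stageN|].
  by right.
suff : I0 `<=` stage t by move=> /(_ _ I0t)/stageN.
elim: tI0 {I0t} => {I0} [I _ IH|S _ IH] x.
  by case=> [/IH//|Dx]; apply: fix_stage; exact: D_mono IH _ Dx.
by case=> I SI; exact: IH.
Qed.

Lemma tower_leE s t : kernel t ->
  tower_le s t <-> stage t s \/ D (stage t) s.
Proof.
move=> kt; split=> [st|h I tI It].
  by apply: (st (stage t `|` D (stage t))); [exact/tower_next/tower_stage|
    exact: stage_next].
have [h'|] := tower_linear tI (tower_stage t); last exact.
by case: (@stageN t); exact: h'.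
Qed.

(** Linearity of the tower confines a descending sequence to the stages before
    the one at which its first term appears. *)
Lemma tower_wf (x : nat -> T) : kernel (x 0) ->
  ~ forall n, stage (x n) (x n.+1).
Proof.
move=> [I tI]; elim: tI x => {I} [I tI IH|S hS IH] x; last first.
  by case=> I SI; exact: IH.
move=> Ix dec; case: (pselect (I (x 0))) => [/IH|nI]; first exact.
have := dec 0; rewrite stageE => -[J [tJ nJ] Jx].
have [JI|IJ] := tower_linear tJ tI; last by apply: nJ; exact: IJ.
by apply: (IH (fun n => x n.+1)) => //; exact: JI.
Qed.

(** The last clause says that the initial segment closed at [t] is the
    successor, in the tower, of the one open at [t]. *)
Definition tower_rel (R : T -> T -> Prop) : Prop :=
  [/\ forall s t, R s t \/ R t s,
      forall s t u, R s t -> R t u -> R s u,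
      forall x : nat -> T, ~ forall n, ~ R (x n) (x n.+1) &
      forall s t, R s t <-> ~ R t s \/ D (fun r => ~ R t r) s].

Lemma tower_rel_tower_le : (forall t, kernel t) -> tower_rel tower_le.
Proof.
move=> kT; split.
- exact: tower_le_total.
- exact: tower_le_trans.
- by move=> x; apply: tower_wf (kT (x 0)).
- by move=> s t; exact: tower_leE (kT t).
Qed.

(** Along a wellfounded relation, the last clause of [tower_rel] forces every
    initial segment to be a stage of the tower; linearity of the tower then
    identifies the relation. *)
Lemma tower_rel_unique R : tower_rel R -> forall s t, R s t <-> tower_le s t.
Proof.
move=> [tot trans wf RE].
pose below t : set T := fun r => ~ R t r.
have RE' t : R^~ t = below t `|` D (below t).
  by apply/seteqP; split=> s /RE.
have refl t : R t t by have [] := tot t t.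
have tower_below t : tower D (below t).
  apply: contrapT => nt.
  (* A segment outside the tower forces an earlier one, contradicting
     wellfoundedness. *)
  have step t' : exists s, ~ tower D (below t') -> ~ R t' s /\ ~ tower D (below s).
    case: (pselect (exists s, ~ R t' s /\ ~ tower D (below s))) => [[s hs]|h].
      by exists s.
    exists t' => nt'; case: nt'.
    have -> : below t' = \bigcup_(I in [set R^~ s | s in below t']) I.
      apply/seteqP; split=> [r tr|r [_ [s ts <-] rs] tr].
        by exists (R^~ r) => //; exists r.
      by apply: ts; exact: trans tr rs.
    apply: tower_sup => _ [s ts <-]; rewrite RE'; apply: tower_next.
    by apply: contrapT => ns; apply: h; exists s.
  have [next hnext] := choice step.
  apply: (wf (fun n => iter n next t)) => n.
  suff : ~ tower D (below (iter n next t)) by move=> /hnext[].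
  by elim: n => //= n IH; have [] := hnext _ IH.
move=> s t; split=> [st I tI It|st].
  have [h|] := tower_linear tI (tower_below t).
    by case: (h _ It); exact: refl.
  by rewrite -RE'; exact.
by apply: (st (R^~ t)) => //; rewrite RE'; exact: tower_next.
Qed.

End TowerOrder.

(** * The topology of the Baire space *)

Lemma agree_sym m x y : agree m x y -> agree m y x.
Proof. by move=> h i im; rewrite h. Qed.
Lemma agree_trans m x y z : agree m x y -> agree m y z -> agree m x z.
Proof. by move=> h h' i im; rewrite h// h'. Qed.
Lemma agree_le m n x y : m <= n -> agree n x y -> agree m x y.
Proof. by move=> mn h i im; apply: h; exact: leq_trans mn. Qed.
Lemma agreeS m x y : agree m x y -> x m = y m -> agree m.+1 x y.
Proof. by move=> h E i; rewrite ltnS leq_eqVlt => /predU1P[->|/h]. Qed.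
Lemma agree_eq x y : (forall m, agree m x y) -> x = y.
Proof. by move=> h; apply: funext => i; exact: (h i.+1). Qed.

Lemma nbhs_agree (x : baire) m : nbhs x [set y | agree m x y].
Proof.
elim: m => [|m IH]; first by apply: filterS filterT => y _.
have h : nbhs x [set y : baire | y m = x m].
  apply: (@proj_continuous nat (fun=> nat) m x [set n | n = x m]).
  exact: discrete_set1.
by apply: filterS2 IH h => y /= h1 h2; apply: agreeS.
Qed.

Lemma nbhs_baireP (x : baire) (U : set baire) :
  nbhs x U <-> exists m, forall y, agree m x y -> U y.
Proof.
split=> [|[m h]]; last by apply: filterS (nbhs_agree x m).
pose G : set_system baire := [set V | exists m, forall y, agree m x y -> V y].
have FG : Filter G.
  split; first by exists 0.
    move=> V W [m hm] [n hn]; exists (maxn m n) => y h.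
    by split; [apply: hm|apply: hn]; apply: agree_le h; lia.
  by move=> V W VW [m hm]; exists m => y /hm/VW.
have h : {ptws, G --> x}.
  apply/pointwise_cvgP => t; apply/discrete_cvg.
  by exists t.+1 => y h; rewrite /= h.
exact: h.
Qed.

Lemma continuous_agree (f : baire -> baire) :
  (forall x l, exists m, forall y, agree m x y -> agree l (f x) (f y)) ->
  continuous f.
Proof.
move=> h x U /nbhs_baireP[l hl]; apply/nbhs_baireP; have [m hm] := h x l.
by exists m => y xy; apply/hl/hm.
Qed.

Lemma within_continuous_agree (Y : set baire) (f : baire -> baire) :
  (forall x l, Y x -> exists m, forall y, Y y -> agree m x y ->
    agree l (f x) (f y)) ->
  {within Y, continuous f}.
Proof.
move=> h; apply/subspace_continuousP => x Yx U /nbhs_baireP[l hl].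
have [m hm] := h x l Yx; apply: filterS (nbhs_agree x m) => y xy Yy.
by apply/hl/hm.
Qed.

Lemma closure_baireP (Y : set baire) x :
  closure Y x <-> forall m, exists2 y, Y y & agree m x y.
Proof.
split=> [h m|h U /nbhs_baireP[m hm]].
  by have [y [Yy xy]] := h _ (nbhs_agree x m); exists y.
by have [y Yy /hm Uy] := h m; exists y.
Qed.

(** * A relatively closed copy of the Baire space *)

Section Scheme.
Variables (A F : set baire) (f : baire -> baire).
Hypothesis f_mod : forall l, exists m, forall y y',
  agree m y y' -> agree l (f y) (f y').
Hypothesis FA : forall y, F y -> A (f y).
Hypothesis F_closed : forall y,
  (forall m, exists2 y', F y' & agree m y y') -> F y.
Hypothesis F_perfect : forall y m, F y ->
  ~ ((forall l, exists k, forall y', F y' -> agree m y y' -> f y' l <= k) /\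
     (forall x, (forall l, exists y', [/\ F y', agree m y y' & agree l x (f y')])
       -> A x)).

(** The ranks are made distinct by letting them increase strictly. *)
Lemma increasing_seq (S : set baire) (r : baire -> nat) :
  (forall k, exists2 y, S y & k <= r y) ->
  exists ys : nat -> baire, (forall n, S (ys n)) /\ (injective (r \o ys)).
Proof.
move=> h; have /choice[ch hch] : forall k, exists y, S y /\ k <= r y.
  by move=> k; have [y Sy ky] := h k; exists y.
pose ks n := iter n (fun k => (r (ch k)).+1) 0.
have mono m n : m < n -> r (ch (ks m)) < r (ch (ks n)).
  elim: n => // n IH; rewrite ltnS leq_eqVlt => mn.
  apply: (@leq_trans (ks n.+1)); last exact: (hch _).2.
  by rewrite /= ltnS; case/predU1P: mn => [->//|/IH/ltnW].
exists (fun n => ch (ks n)); split=> [n|m n /= E]; first exact: (hch _).1.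
by case: (ltngtP m n) => // /mono; rewrite E ltnn.
Qed.

(** The cylinders around the [f (ys n)] form a discrete family in [A]: they
    can only accumulate at infinity or at a point outside [A]. *)
Lemma splitting y m : F y -> exists (ys : nat -> baire) (ls : nat -> nat),
  [/\ forall n, F (ys n) /\ agree m y (ys n),
      forall n n' x, agree (ls n) (f (ys n)) x ->
        agree (ls n') (f (ys n')) x -> n = n' &
      forall x, A x ->
        (forall k, exists n x', agree k x x' /\ agree (ls n) (f (ys n)) x') ->
        exists n, agree (ls n) (f (ys n)) x].
Proof.
move=> Fy; pose S : set baire := [set y' | F y' /\ agree m y y'].
have /not_andP[/existsNP[l hl]|/existsNP[x0 /not_implyP[hx nA]]] :=
  F_perfect (m := m) Fy.
- have [|ys [Sys inj]] := @increasing_seq S (fun y' => f y' l).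
    move=> k; apply: contrapT => h; apply: hl; exists k => y' Fy' yy'.
    rewrite leqNgt; apply/negP => /ltnW lt; apply: h.
    by exists y'.
  exists ys, (fun=> l.+1); split=> // [n n' x h h'|x _ /(_ l.+1)].
    by apply: inj; rewrite /= h// h'.
  move=> [n [x' [h h']]]; exists n.
  by apply: agree_trans h' _; exact: agree_sym.
have neq y' : F y' -> exists d, f y' d != x0 d.
  move=> /FA Afy; apply: contrapT => h; apply: nA.
  have -> // : x0 = f y'; apply: funext => d.
  by apply/eqP; apply: contrapT => ne; apply: h; exists d; rewrite eq_sym; exact/negP.
have /choice[r hr] : forall y', exists d, F y' ->
    f y' d <> x0 d /\ agree d x0 (f y').
  move=> y'; case: (pselect (F y')) => [Fy'|]; last by exists 0.
  exists (ex_minn (neq _ Fy')) => _; case: ex_minnP => d /eqP ne least.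
  split=> // i id; apply/eqP; apply: contraT; rewrite eq_sym => /least.
  by rewrite leqNgt id.
have [|ys [Sys inj]] := @increasing_seq S r.
  move=> k; have [y' [Fy' yy' xy']] := hx k; exists y' => //.
  by rewrite leqNgt; apply/negP => /xy' E; have [] := hr _ Fy'; rewrite E.
have uniq n x d : agree (r (ys n)).+1 (f (ys n)) x -> agree d x0 x ->
    x0 d <> x d -> r (ys n) = d.
  have [/hr[ne ag] _] := Sys n => h h' ne'.
  case: (ltngtP (r (ys n)) d) => // lt.
    by case: ne; rewrite h// h'.
  by case: ne'; rewrite -h ?ag//; exact: ltnW.
have first n x : agree (r (ys n)).+1 (f (ys n)) x ->
    agree (r (ys n)) x0 x /\ x0 (r (ys n)) <> x (r (ys n)).
  have [/hr[ne ag] _] := Sys n => h; split; last by rewrite -h// => E; exact: ne.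
  by apply: agree_trans ag _; apply: agree_le h.
(* A cylinder that determines the first place where [f (ys n)] leaves [x0]. *)
exists ys, (fun n => (r (ys n)).+1); split=> // [n n' x h h'|x Ax h].
  by apply: inj; have [h1 h2] := first _ _ h'; exact: uniq h h1 h2.
have [d [ne ag]] : exists d, x0 d <> x d /\ agree d x0 x.
  have ex : exists d, x0 d != x d.
    apply: contrapT => h'; apply: nA; have -> // : x0 = x; apply: funext => d.
    by apply/eqP; apply: contrapT => ne; apply: h'; exists d; exact/negP.
  exists (ex_minn ex); case: ex_minnP => d /eqP ne least; split=> // i id.
  by apply/eqP; apply: contraT => /least; rewrite leqNgt id.
have [n [x' [xx' h']]] := h d.+1; exists n.
have rd : r (ys n) = d.
  apply: (uniq n x') => //; last by rewrite -xx'.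
  by apply: agree_trans ag _; exact: agree_le xx'.
by apply: agree_trans h' _; rewrite rd; exact: agree_sym.
Qed.

Definition node : Type := (baire * nat)%type.

(** The splitting at every node, together with neighbourhoods of the points
    chosen that [f] maps into the cylinders. A node [(y, m)] stands for the
    basic neighbourhood of the points that agree with [y] below [m]. *)
Lemma node_children : exists (ch : node -> nat -> node) (ls : node -> nat -> nat),
  forall v, F v.1 ->
  [/\ forall n, [/\ F (ch v n).1, agree v.2 v.1 (ch v n).1, v.2 < (ch v n).2 &
        forall y, agree (ch v n).2 (ch v n).1 y ->
          agree (ls v n) (f (ch v n).1) (f y)],
      forall n n' x, agree (ls v n) (f (ch v n).1) x ->
        agree (ls v n') (f (ch v n').1) x -> n = n' &
      forall x, A x ->
        (forall k, exists n x', agree k x x' /\ agree (ls v n) (f (ch v n).1) x') ->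
        exists n, agree (ls v n) (f (ch v n).1) x].
Proof.
have [md hmd] := choice f_mod.
suff /choice[c hc] : forall v : node, exists c : (nat -> node) * (nat -> nat),
  F v.1 ->
  [/\ forall n, [/\ F (c.1 n).1, agree v.2 v.1 (c.1 n).1, v.2 < (c.1 n).2 &
        forall y, agree (c.1 n).2 (c.1 n).1 y ->
          agree (c.2 n) (f (c.1 n).1) (f y)],
      forall n n' x, agree (c.2 n) (f (c.1 n).1) x ->
        agree (c.2 n') (f (c.1 n').1) x -> n = n' &
      forall x, A x ->
        (forall k, exists n x', agree k x x' /\ agree (c.2 n) (f (c.1 n).1) x') ->
        exists n, agree (c.2 n) (f (c.1 n).1) x].
  by exists (fun v => (c v).1), (fun v => (c v).2).
move=> [y m]; case: (pselect (F y)) => [Fy|nF]; last first.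
  by exists (fun=> (y, m), fun=> m).
have [ys [ls [h1 h2 h3]]] := splitting m Fy.
(* Long enough to proceed and to decide the image up to [ls n]. *)
exists (fun n => (ys n, maxn m.+1 (md (ls n))), ls) => _ /=; split=> // n.
have [Fn ag] := h1 n; split=> //; first by lia.
by move=> y' h; apply: hmd; apply: agree_le h; lia.
Qed.

(** [g a] is the image of the limit of the nodes along the branch [a]. It can be
    decoded since the cylinders at a node are disjoint. A point [x] of [A] in the
    closure of the range lies in a cylinder at the root, as these only cluster
    outside [A], then in one at the corresponding child, and so on; this branch
    is sent to [x]. *)
Lemma closed_copy y0 : F y0 -> exists g : baire -> baire,
  [/\ forall l, exists m, forall a b, agree m a b -> agree l (g a) (g b),
      forall a k, exists l, forall b, agree l (g a) (g b) -> agree k a b,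
      forall a, A (g a) &
      forall x, A x -> (forall m, exists b, agree m x (g b)) ->
        exists a, g a = x].
Proof.
move=> Fy0; have [ch [ls hch]] := node_children.
pose nd (a : baire) k := iteri k (fun i v => ch v (a i)) (y0, 0).
have ndS a k : nd a k.+1 = ch (nd a k) (a k) by [].
have Fnd a k : F (nd a k).1.
  by elim: k => // k IH; rewrite ndS; have [/(_ (a k))[]] := hch _ IH.
have nd_agree a j k : j <= k -> agree (nd a j).2 (nd a j).1 (nd a k).1 /\
    (nd a j).2 + (k - j) <= (nd a k).2.
  move=> /subnK <-; elim: (k - j) => [|d [IH1 IH2]]; first by rewrite add0n subnn addn0.
  have [/(_ (a (d + j)))[_ h1 h2 _] _ _] := hch _ (Fnd a (d + j)).
  rewrite addSn ndS; split; last by lia.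
  by apply: agree_trans IH1 _; apply: agree_le h1; lia.
have nd_ge a k : k <= (nd a k).2 by have [_] := nd_agree a 0 k isT; lia.
pose lim (a : baire) : baire := fun i => (nd a i.+1).1 i.
have lim_agree a k : agree (nd a k).2 (nd a k).1 (lim a).
  move=> i ik; rewrite /lim; case: (leqP k i.+1) => [ki|/ltnW ki].
    by have [h _] := nd_agree a _ _ ki; exact: h.
  have [h _] := nd_agree a _ _ ki; rewrite h//; exact: leq_trans (nd_ge a i.+1).
have nd_eq a b k : agree k a b -> nd a k = nd b k.
  elim: k => // k IH ag; rewrite !ndS ag// IH//.
  by apply: agree_le ag.
have Flim a : F (lim a).
  apply: F_closed => m; exists (nd a m).1 => //; apply: agree_sym.
  exact: agree_le (lim_agree a m).
pose U v n x := agree (ls v n) (f (ch v n).1) x.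
have Ulim a k : U (nd a k) (a k) (f (lim a)).
  have [/(_ (a k))[_ _ _ h] _ _] := hch _ (Fnd a k).
  by apply: h; rewrite -ndS; exact: lim_agree.
have Uinj a k n n' x : U (nd a k) n x -> U (nd a k) n' x -> n = n'.
  by have [_ h _] := hch _ (Fnd a k); exact: h.
have cont l : exists m, forall a b, agree m a b ->
    agree l (f (lim a)) (f (lim b)).
  have [m hm] := f_mod l; exists m => a b ab; apply: hm.
  have h c : agree m (nd c m).1 (lim c) by apply: agree_le (lim_agree c m).
  by apply: agree_trans (h b); rewrite -(nd_eq _ _ _ ab); exact: agree_sym.
exists (fun a => f (lim a)); split=> //.
- move=> a k.
  have [l hl] : exists l, forall i, i < k -> ls (nd a i) (a i) <= l.
    apply: (@uniform_bound (fun i l => ls (nd a i) (a i) <= l)) => [i m n mn h|i].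
      exact: leq_trans mn.
    by exists (ls (nd a i) (a i)).
  exists l => b ab.
  have : forall i, i <= k -> agree i a b.
    elim=> // i IH ik; have abi := IH (ltnW ik); apply: agreeS => //.
    apply: (Uinj b i) (Ulim b i); rewrite -(nd_eq _ _ _ abi).
    by apply: agree_trans (Ulim a i) _; apply: agree_le ab; exact: hl.
  exact.
- by move=> a; apply/FA/Flim.
move=> x Ax apx.
(* Follow the branch whose cylinders contain [x]: discreteness of each family
   of cylinders in [A] guarantees that it never dies out. *)
pose approx (a : baire) k := forall m, exists b, agree k a b /\ agree m x (f (lim b)).
have /choice[nxt hnxt] : forall ak : baire * nat, exists a', approx ak.1 ak.2 ->
    agree ak.2 ak.1 a' /\ approx a' ak.2.+1.
  move=> -[a k] /=; case: (pselect (approx a k)) => [ap|]; last by exists a.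
  have [_ _ /(_ x Ax)[|n Un]] := hch _ (Fnd a k).
    move=> m; have [b [ab xb]] := ap m; exists (b k), (f (lim b)); split=> //.
    by rewrite (nd_eq _ _ _ ab); exact: Ulim.
  have here b : agree k a b -> agree (ls (nd a k) n) x (f (lim b)) -> b k = n.
    move=> ab xb; apply: (Uinj b k _ _ _ (Ulim b k)); rewrite -(nd_eq _ _ _ ab).
    exact: agree_trans Un xb.
  have [a' [aa' xa']] := ap (ls (nd a k) n); exists a' => _; split=> // m.
  have [b [ab xb]] := ap (maxn m (ls (nd a k) n)); exists b; split; last first.
    by apply: agree_le xb; lia.
  apply: agreeS; first by apply: agree_trans ab; exact: agree_sym.
  by rewrite !here//; apply: agree_le xb; lia.
pose seqa k := iteri k (fun i a => nxt (a, i)) (fun=> 0 : nat).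
have apx_seqa k : approx (seqa k) k.
  elim: k => [m|k IH]; first by have [b hb] := apx m; exists b.
  by have [] := hnxt (seqa k, k) IH.
have seqa_agree j k : j <= k -> agree j (seqa j) (seqa k).
  move=> /subnK <-; elim: (k - j) => // d IH; apply: agree_trans IH _.
  have [h _] := hnxt (seqa (d + j), d + j) (apx_seqa (d + j)).
  by rewrite addSn; apply: agree_le h; rewrite /=; lia.
pose a : baire := fun i => seqa i.+1 i.
have a_agree k : agree k a (seqa k).
  by move=> i ik; rewrite /a (seqa_agree _ _ ik).
exists a; apply: agree_eq => l; have [m hm] := cont l.
have [b [ab xb]] := apx_seqa m (l).
apply: agree_trans (agree_sym xb); apply: hm.
exact: agree_trans (a_agree m) ab.
Qed.

Lemma closed_copy_homeomorphic y0 : F y0 -> exists Y : set baire,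
  [/\ Y `<=` A, homeomorphic_to_baire Y & relatively_closed A Y].
Proof.
move=> /closed_copy[g [g_cont g_open gA g_closed]].
have g_inj a b : g a = g b -> a = b.
  move=> E; apply: agree_eq => k; have [l] := g_open a k; apply.
  by rewrite E.
have /choice[h hK] : forall x, exists a, range g x -> g a = x.
  move=> x; case: (pselect (range g x)) => [[a _ <-]|]; first by exists a.
  by exists x.
have gK : cancel g h by move=> a; apply: g_inj; apply: hK; exists a.
exists (range g); split.
- by move=> _ [a _ <-].
- exists g, h; split=> //.
    apply: continuous_agree => x l; have [m hm] := g_cont l.
    by exists m => y; exact: hm.
  apply: within_continuous_agree => _ l [a _ <-]; have [m hm] := g_open a l.
  by exists m => _ [b _ <-] /hm; rewrite !gK.
exists (closure (range g)); first exact: closed_closure.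
apply/seteqP; split=> [_ [a _ <-]|x [Ax /closure_baireP clx]].
  by split=> //; apply: subset_closure; exists a.
have [|a <-] := g_closed x Ax; last by exists a.
by move=> m; have [_ [b _ <-] xb] := clx m; exists b.
Qed.

End Scheme.

(** * The derivative *)

Definition prefix_code (y : baire) (m : nat) : nat := CodeSeq.code (mkseq y m).

Lemma eq_mkseq_agree (x y : baire) m : mkseq x m = mkseq y m <-> agree m x y.
Proof.
split=> [E i im|ag]; last first.
  by apply/eq_in_map => i; rewrite mem_iota => /andP[_ im]; exact: ag.
by have := congr1 (fun s => nth 0 s i) E; rewrite !nth_mkseq.
Qed.

Lemma prefix_code_inj x y m n :
  prefix_code x m = prefix_code y n -> m = n /\ agree m x y.
Proof.
move=> /(can_inj CodeSeq.codeK) E.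
have mn : m = n by have := congr1 size E; rewrite !size_mkseq.
by split=> //; move: E; rewrite -mn => /eq_mkseq_agree.
Qed.

Lemma prefix_code_agree m x y : agree m x y -> prefix_code x m = prefix_code y m.
Proof. by move=> /eq_mkseq_agree E; rewrite /prefix_code E. Qed.

Section Derivative.
Variables (C : set baire) (f : baire -> baire).

Definition piece (t : nat) (I : set nat) : set baire :=
  [set y | [/\ C y, exists m, prefix_code y m = t & forall m, ~ I (prefix_code y m)]].

(** A closed subset of the Baire space is compact when it is bounded at each
    coordinate, so the two clauses say that the image of [piece t I] has a
    compact closure contained in [f @` C]. They avoid strings, which keeps the
    defining formula simple. *)
Definition derivative (I : set nat) : set nat :=
  [set t | (forall m, exists k, forall y, piece t I y -> f y m <= k) /\
    forall x, (forall m, exists y, piece t I y /\ agree m x (f y)) ->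
      exists y, C y /\ forall k, f y k = x k].

Lemma piece_anti t I J : I `<=` J -> piece t J `<=` piece t I.
Proof. by move=> IJ y [Cy ty nJ]; split=> // m /IJ; exact: nJ. Qed.

Lemma derivative_mono I J : I `<=` J -> derivative I `<=` derivative J.
Proof.
move=> IJ t [bd cl]; split=> [m|x hx].
  by have [k hk] := bd m; exists k => y /(piece_anti IJ); exact: hk.
apply: cl => m; have [y [py xy]] := hx m; exists y; split=> //.
exact: piece_anti py.
Qed.

Definition piece_tree (t : nat) (I : set nat) : set (seq nat) :=
  [set u | exists y m, piece t I y /\ u = mkseq (f y) m].

Lemma piece_tree_compact t I : derivative I t -> compact_tree (piece_tree t I).
Proof.
move=> [bd _]; split.
- move=> u [n [y [m [py E]]]]; exists y, (size u); split=> //.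
  have hm : m = (size u).+1 by have := congr1 size E; rewrite size_rcons size_mkseq.
  by move: E; rewrite hm mkseqS => /rcons_inj[].
- move=> u [y [m [py ->]]]; exists (f y m); exists y, m.+1; split=> //.
  by rewrite mkseqS.
move=> u _; have [k hk] := bd (size u).
apply: sub_finite_set (finite_II k.+1) => n [y [m [py E]]] /=.
have hm : m = (size u).+1 by have := congr1 size E; rewrite size_rcons size_mkseq.
by move: E; rewrite hm mkseqS => /rcons_inj[_ ->]; rewrite ltnS; exact: hk.
Qed.

Lemma body_piece_tree t I x :
  body (piece_tree t I) x <-> forall m, exists y, piece t I y /\ agree m x (f y).
Proof.
split=> h m.
  have [y [n [py E]]] := h m; exists y; split=> //; apply/eq_mkseq_agree.
  by rewrite E; have := congr1 size E; rewrite !size_mkseq => ->.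
have [y [py /eq_mkseq_agree E]] := h m.
by exists y, m.
Qed.

Local Notation D := derivative.

(** If every point of [C] is discarded then so is every neighbourhood: what is
    left in it is empty. *)
Lemma kernel_full : (forall y, C y -> exists m, kernel D (prefix_code y m)) ->
  forall t, kernel D t.
Proof.
move=> cov t; apply: kernel_closed.
have no_piece y : ~ piece t (kernel D) y.
  by move=> [Cy _ nk]; have [m] := cov y Cy; exact: nk.
split=> [m|x hx]; last by have [y [/no_piece]] := hx 0.
by exists 0 => y /no_piece.
Qed.

Definition derived_tree (t : nat) : set (seq nat) := piece_tree t (stage D t).

Lemma derivative_stage t : kernel D t -> D (stage D t) t.
Proof.
by move=> /(stage_next derivative_mono)[st|//]; case: (stageN st).
Qed.

(** The first neighbourhood of [y] to be discarded still contains [y] just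
    before that stage. *)
Lemma sigma_compact_decomposition : (forall t, kernel D t) ->
  f @` C = \bigcup_t body (derived_tree t).
Proof.
move=> kT; apply/seteqP; split=> [_ [y Cy <-]|x [t _ /body_piece_tree h]].
  have [m hm] : exists m, forall n,
      ~ stage D (prefix_code y m) (prefix_code y n).
    apply: contrapT => /forallNP h.
    have /choice[nxt hnxt] : forall m, exists n,
        stage D (prefix_code y m) (prefix_code y n).
      by move=> m; have /existsNP[n /contrapT hn] := h m; exists n.
    apply: (@tower_wf _ D (fun k => prefix_code y (iter k nxt 0))) => [|k].
      exact: kT.
    exact: hnxt.
  exists (prefix_code y m) => //; apply/body_piece_tree => l; exists y.
  by split=> //; split=> //; exists m.
have [y [Cy E]] := (derivative_stage (kT t)).2 x h.
by exists y => //; apply: funext.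
Qed.

Hypothesis C_closed : forall y, (forall m, exists2 y', C y' & agree m y y') -> C y.
Hypothesis f_mod : forall l, exists m, forall y y',
  agree m y y' -> agree l (f y) (f y').

(** The points that survive the iteration form a closed set none of whose
    neighbourhoods can be discarded: the hypotheses of the construction of a
    closed copy. *)
Lemma kernel_dichotomy : (forall t, kernel D t) \/ exists Y : set baire,
  [/\ Y `<=` f @` C, homeomorphic_to_baire Y & relatively_closed (f @` C) Y].
Proof.
case: (pselect (forall y, C y -> exists m, kernel D (prefix_code y m))).
  by move=> h; left; exact: kernel_full.
move=> /existsNP[y0 /not_implyP[Cy0 /forallNP y0k]]; right.
pose F : set baire := [set y | C y /\ forall m, ~ kernel D (prefix_code y m)].
have pieceF y y' m : piece (prefix_code y m) (kernel D) y' <->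
    F y' /\ agree m y y'.
  split=> [[Cy' [n E] ny']|[[Cy' ny'] ag]].
    by have [-> /agree_sym ag] := prefix_code_inj E.
  split=> //; exists m; apply: prefix_code_agree; exact: agree_sym.
apply: (@closed_copy_homeomorphic _ F f) (conj Cy0 y0k) => //.
- by move=> y [Cy _]; exists y.
- move=> y h; split=> [|m].
    by apply: C_closed => m; have [y' [Cy' _] ag] := h m; exists y'.
  by have [y' [_ ny'] /prefix_code_agree->] := h m; exact: ny'.
move=> y m Fy [bd cl]; apply: (Fy.2 m); apply: kernel_closed; split=> [l|x hx].
  by have [k hk] := bd l; exists k => y' /pieceF[]; exact: hk.
have [|y' Cy' <-] := cl x; last by exists y'.
move=> l; have [y' [/pieceF[Fy' ag] xy]] := hx l.
by exists y'.
Qed.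

End Derivative.

(** * The two alternatives exclude each other *)

Lemma body_closed (T : set (seq nat)) : closed (body T).
Proof.
move=> x /closure_baireP clx m; have [y hy /eq_mkseq_agree ->] := clx m.
exact: hy.
Qed.

(** Finite branching bounds each level, so the body is closed in a product of
    finite sets. *)
Lemma compact_body (T : set (seq nat)) : compact_tree T -> compact (body T).
Proof.
move=> [tT _ finT].
have level m : exists b, forall x, body T x -> forall i, i < m -> x i <= b.
  have fin : finite_set [set u | exists2 x, body T x & u = mkseq x m].
    elim: m => [|m IH].
      by apply: sub_finite_set (finite_set1 [::]) => u [x _ ->].
    apply: sub_finite_set (_ : finite_set
      (\bigcup_(u in [set u | exists2 x, body T x & u = mkseq x m])
         [set rcons u n | n in [set n | T (rcons u n)]])).
      move=> _ [x bx ->]; exists (mkseq x m); first by exists x.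
      by exists (x m); rewrite /= -mkseqS//; exact: bx.
    apply: bigcup_finite => // _ [x bx ->].
    by apply/finite_image/finT/bx.
  have [b hb] : exists b, forall u, (exists2 x, body T x & u = mkseq x m) ->
      forall i, i < m -> nth 0 u i <= b.
    have /finite_seqP[s hs] := fin.
    exists (\max_(u <- s) \max_(i < m) nth 0 u i) => u hu i im.
    have us : u \in s by have : [set` s] u by rewrite -hs.
    apply: leq_trans (@leq_bigmax_seq _ s predT _ u us isT).
    by rewrite (bigmax_sup (Ordinal im)).
  by exists b => x bx i im; have := hb _ (ex_intro2 _ _ x bx erefl) i im;
    rewrite nth_mkseq.
have /choice[b hb] : forall i, exists b, forall x, body T x -> x i <= b.
  by move=> i; have [b hb] := level i.+1; exists b => x bx; exact: hb.
have cpt : compact [set x : baire | forall i, x i <= b i].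
  apply: (@tychonoff nat (fun=> nat) (fun i => [set n | n <= b i])) => i.
  apply: finite_compact; apply: sub_finite_set (finite_II (b i).+1) => n /=.
  by rewrite ltnS.
have -> : body T = [set x : baire | forall i, x i <= b i] `&` body T.
  by apply/seteqP; split=> [x bx|x []//]; split=> // i; exact: hb.
exact: compact_closedI cpt (@body_closed T).
Qed.

Lemma compact_bounded (K : set baire) i : compact K ->
  exists b, forall x, K x -> x i <= b.
Proof.
move=> /compact_near_coveringP cK.
have [b _ hb] : \forall b \near \oo, K `<=` [set x : baire | x i <= b].
  apply: (cK nat \oo (fun b x => x i <= b)) => x _.
  exists ([set y | agree i.+1 x y], [set b | x i <= b]).
    by split; [exact: nbhs_agree|exists (x i)].
  by move=> [y b] /= [xy]; rewrite -xy.
by exists b; exact: (hb b (leqnn b)).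
Qed.

Lemma sigma_compact_no_closed_copy (A Y : set baire) (T : nat -> set (seq nat)) :
  (forall n, compact_tree (T n)) -> A = \bigcup_n body (T n) ->
  Y `<=` A -> homeomorphic_to_baire Y -> ~ relatively_closed A Y.
Proof.
move=> cT AE YA [f [g [f_cont g_cont fK YE]]] [Z clZ YZ].
have cY n : compact (Y `&` body (T n)).
  have -> : Y `&` body (T n) = body (T n) `&` Z.
    apply/seteqP; split=> [x [Yx bx]|x [bx Zx]].
      by split=> //; move: Yx; rewrite YZ => -[].
    by split=> //; rewrite YZ AE; split=> //; exists n.
  exact: compact_closedI (compact_body (cT n)) clZ.
have /choice[b hb] : forall n, exists b, forall x, Y x -> body (T n) x -> g x n <= b.
  move=> n; have cg : compact (g @` (Y `&` body (T n))).
    apply: continuous_compact (cY n).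
    by apply: continuous_subspaceW g_cont; exact: subIsetl.
  have [b hb] := compact_bounded n cg; exists b => x Yx bx.
  by apply: hb; exists x.
(* The diagonal point escapes the bound of every piece. *)
pose d : baire := fun n => (b n).+1.
have Yfd : Y (f d) by rewrite -YE; exists d.
have := YA _ Yfd; rewrite AE => -[n _ bn].
by have := hb n _ Yfd bn; rewrite fK ltnn.
Qed.

(** * Definability of the derivative *)

(** The code of a sequence is computed from its end by a recursion involving
    powers of 2; quantifying over tables of both replaces the recursion by
    an arithmetical condition. *)
Lemma prefix_codeP y m c : prefix_code y m = c <->
  exists p g : baire,
    p 0 = 1 /\ (forall k, p k.+1 = 2 * p k) /\
    g m = 0 /\ (forall i, i < m -> g i = p (y i) * (2 * g i.+1).+1) /\ g 0 = c.
Proof.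
have step i : i < m -> CodeSeq.code (drop i (mkseq y m)) =
    2 ^ y i * (2 * CodeSeq.code (drop i.+1 (mkseq y m))).+1.
  by move=> im; rewrite (drop_nth 0) ?size_mkseq//= nth_mkseq// mul2n.
split=> [<-|[p [g [p0 [pS [gm [gS <-]]]]]]].
  (* [p] tabulates the powers of 2 and [g] the codes of the final segments. *)
  exists (fun k => 2 ^ k), (fun i => CodeSeq.code (drop i (mkseq y m))).
  split=> //; split=> [k|]; first by rewrite expnS.
  split; first by rewrite drop_oversize // size_mkseq.
  by split=> [i /step//|]; rewrite drop0.
have pE k : p k = 2 ^ k by elim: k => [//|k IH]; rewrite pS IH expnS.
have gE j : j <= m -> g (m - j) = CodeSeq.code (drop (m - j) (mkseq y m)).
  elim: j => [_|j IH jm]; first by rewrite subn0 gm drop_oversize // size_mkseq.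
  have E : (m - j.+1).+1 = m - j by lia.
  have mj : m - j.+1 < m by lia.
  by rewrite (gS _ mj) (step _ mj) E pE (IH (ltnW jm)).
by have := gE m (leqnn m); rewrite subnn drop0 => ->.
Qed.

Lemma Dl_prefix_code n h g c : fun_definable h -> term_definable g ->
  term_definable c ->
  Dl n.+1 (fun e F => prefix_code (h e F) (g e F) = c e F).
Proof.
move=> hh hg hc; apply: (@Dl_le 1) => //.
have sg : Sg 1 (fun e F => prefix_code (F 0) (e 0) = e 1).
  apply: (@eq_Sg _ (fun e F => exists p g : baire,
    p 0 = 1 /\ (forall k, p k.+1 = 2 * p k) /\ g (e 0) = 0 /\
    (forall i, i < e 0 -> g i = p (F 0 i) * (2 * g i.+1).+1) /\ g 0 = e 1)).
    by move=> e F; rewrite prefix_codeP.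
  do 2 apply: Sg_exF; apply: proj1.
  apply: Dl_and; first by apply: Dl_eq; td.
  apply: Dl_and; first by apply: Dl_allN; apply: Dl_eq; td.
  apply: Dl_and; first by apply: Dl_eq; td.
  apply: Dl_and; last by apply: Dl_eq; td.
  by apply: Dl_allN; apply: Dl_imp; [apply: Dl_lt|apply: Dl_eq]; td.
pose s (e : nat -> nat) (F : assignment) := g e F .: (c e F .: e).
pose t (e : nat -> nat) (F : assignment) := h e F .: F.
have hs i : term_definable (fun e F => s e F i).
  by rewrite /s; case: i => [|[|i]] /=; td.
have ht i : fun_definable (fun e F => t e F i).
  by rewrite /t; case: i => [|i] /=; [exact: hh|td].
apply: (Dl_sub (P := fun e F => prefix_code (F 0) (e 0) = e 1) hs ht).
split=> //.
(* The graph of a total function is Delta as soon as it is Sigma: its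
   complement says that the value is some other number. *)
apply: (@eq_Sg _ (fun e F => exists c', prefix_code (F 0) (e 0) = c' /\ c' <> e 1)).
  by move=> e F; split=> [[_ [<-]]|h']//; exists (prefix_code (F 0) (e 0)).
apply: Sg_exN; apply: Sg_and.
  pose s' (e : nat -> nat) (F : assignment) := e 1 .: (e 0 .: e).
  have hs' i : term_definable (fun e F => s' e F i).
    by rewrite /s'; case: i => [|[|i]] /=; td.
  have ht' i : fun_definable (fun e F => F i) by td.
  exact: (Sg_sub hs' ht' sg).
by apply: proj1; apply: Dl_not; apply: Dl_eq; td.
Qed.

Ltac dl := repeat (cbv beta; first
  [ assumption
  | match goal with
    | |- Dl _ (fun e F => _ /\ _) => apply: Dl_and
    | |- Dl _ (fun e F => _ \/ _) => apply: Dl_or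
    | |- Dl _ (fun e F => ~ _) => apply: Dl_not
    | |- Dl _ (fun e F => _ -> _) => apply: Dl_imp
    | |- Dl _ (fun e F => exists _ : nat, _) => apply: Dl_exN
    | |- Dl _ (fun e F => forall _ : nat, _) => apply: Dl_allN
    | |- Dl _ (fun e F => prefix_code _ _ = _) => apply: Dl_prefix_code
    | |- Dl _ (fun e F => _ = _) => apply: Dl_eq
    | |- Dl _ (fun e F => is_true (_ < _)) => apply: Dl_lt
    end
  | progress td ]).

Section DerivativeDefinability.
Variable C : set baire.
Hypothesis C_definable : Dl 1 (fun _ F => C (F 0)).

(** A relation between numbers is coded by the zeros of a function. *)
Definition code_rel (x : baire) (s t : nat) : Prop := x (npair s t) = 0.

Local Notation f := (slice 0).
Local Notation D := (derivative C f).
Local Notation below x t := (fun r => ~ code_rel x t r).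

Lemma Dl_C n (h : (nat -> nat) -> assignment -> baire) : fun_definable h ->
  Dl n.+1 (fun e F => C (h e F)).
Proof.
move=> hh; apply: (@Dl_le 1) => //.
pose t (e : nat -> nat) (F : assignment) := h e F .: F.
have hs i : term_definable (fun e _ => e i) by td.
have ht i : fun_definable (fun e F => t e F i).
  by rewrite /t; case: i => [|i] /=; [exact: hh|td].
exact: (Dl_sub hs ht C_definable).
Qed.

Lemma Dl_piece n h k g t : fun_definable h -> fun_definable k ->
  term_definable g -> term_definable t ->
  Dl n.+1 (fun e F => piece C (g e F) (below (k e F) (t e F)) (h e F)).
Proof.
move=> hh hk hg ht; apply: (@Dl_le 1) => //.
have main : Dl 1 (fun e F => piece C (e 0) (below (F 1) (e 1)) (F 0)).
  apply: (@eq_Dl _ (fun e F => C (F 0) /\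
    (exists m, prefix_code (F 0) m = e 0) /\
    forall m c, prefix_code (F 0) m = c -> F 1 (npair (e 1) c) = 0)).
    move=> e F; split=> [[Cy [ty h1]]|[Cy ty h1]].
      by split=> // m; apply; exact: h1.
    by split=> //; split=> // m _ <-; apply: contrapT; exact: h1.
  by rewrite /npair; dl; apply: Dl_C; td.
pose s' (e : nat -> nat) (F : assignment) := g e F .: (t e F .: e).
pose t' (e : nat -> nat) (F : assignment) := h e F .: (k e F .: F).
have hs' i : term_definable (fun e F => s' e F i).
  by rewrite /s'; case: i => [|[|i]] /=; td.
have ht' i : fun_definable (fun e F => t' e F i).
  by rewrite /t'; case: i => [|[|i]] /=; [exact: hh|exact: hk|td].
exact: (Dl_sub hs' ht' main).
Qed.

(** Boundedness is a combination of Pi^1_1 conditions. The inclusion of the closure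
    in [f @` C] quantifies universally over functions with a Delta^1_2 matrix. *)
Lemma Dl_derivative g t : term_definable g -> term_definable t ->
  Dl 3 (fun e F => D (below (F 0) (t e F)) (g e F)).
Proof.
move=> hg ht.
have main : Dl 3 (fun e F => D (below (F 0) (e 1)) (e 0)).
  apply: Dl_and.
    apply: Dl_allN; apply: Dl_exN; apply: Dl_le (isT : 2 <= 3) _.
    apply: Dl_allF; apply: Dl_imp; first by apply: Dl_piece; td.
    apply: (@eq_Dl _ (fun e F => F 0 (npair 0 (e 1)) < (e 0).+1)) => //.
    by rewrite /npair; dl.
  apply: Dl_allF; apply: Dl_imp.
    apply: Dl_allN; apply: Dl_exF; apply: Dl_and; first by apply: Dl_piece; td.
    by rewrite /agree; dl.
  apply: Dl_exF; apply: Dl_and; first by apply: Dl_C; td.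
  by dl.
pose s' (e : nat -> nat) (F : assignment) := g e F .: (t e F .: e).
have hs' i : term_definable (fun e F => s' e F i).
  by rewrite /s'; case: i => [|[|i]] /=; td.
have ht' i : fun_definable (fun e F => F i) by td.
exact: (Dl_sub hs' ht' main).
Qed.

Lemma Dl_tower_rel : Dl 3 (fun _ F => tower_rel D (code_rel (F 0))).
Proof.
apply: (@eq_Dl _ (fun e F =>
  (forall s t, code_rel (F 0) s t \/ code_rel (F 0) t s) /\
  (forall s t u, code_rel (F 0) s t -> code_rel (F 0) t u -> code_rel (F 0) s u) /\
  (forall x : baire, ~ forall n, ~ code_rel (F 0) (x n) (x n.+1)) /\
  (forall s t, (code_rel (F 0) s t ->
      ~ code_rel (F 0) t s \/ D (below (F 0) t) s) /\
    (~ code_rel (F 0) t s \/ D (below (F 0) t) s -> code_rel (F 0) s t)))).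
  move=> e F; split=> [[h1 [h2 [h3 h4]]]|[h1 h2 h3 h4]].
    by split=> // s t; split; apply (h4 s t).
  by split=> //; split=> //; split=> // s t; split=> /h4.
have Dl_rel n i g h : term_definable g -> term_definable h ->
    Dl n (fun e F => code_rel (F i) (g e F) (h e F)).
  by move=> hg hh; rewrite /code_rel /npair; dl.
apply: Dl_and; first by dl; apply: Dl_rel; td.
apply: Dl_and; first by dl; apply: Dl_rel; td.
apply: Dl_and.
  by apply: Dl_allF; dl; apply: Dl_rel; td.
apply: Dl_allN; apply: Dl_allN.
by apply: Dl_and; apply: Dl_imp; try apply: Dl_or; try apply: Dl_not;
  try (apply: Dl_rel; td); apply: Dl_derivative; td.
Qed.

Lemma code_of_rel (R : nat -> nat -> Prop) : exists x, forall s t,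
  code_rel x s t <-> R s t.
Proof.
have [x hx] := slice_surj (fun s t => if pselect (R s t) then 0 else 1).
exists x => s t; have -> : code_rel x s t <-> slice s x t = 0 by [].
by rewrite hx; case: pselect.
Qed.

(** Uniqueness of the prewellordering turns the existential definition of the
    trees into a universal one. *)
Lemma Dl_derived_tree : (forall t, kernel D t) ->
  Dl 3 (fun e _ => derived_tree C f (e 0) (CodeSeq.decode (e 1))).
Proof.
move=> kT.
pose in_tree (x : baire) n c := exists y, piece C n (below x n) y /\
  exists m, prefix_code (f y) m = c.
have in_treeE x n c : tower_rel D (code_rel x) ->
    in_tree x n c <-> derived_tree C f n (CodeSeq.decode c).
  move=> hx; have xE := tower_rel_unique hx.
  have -> : in_tree x n c <-> piece_tree C f n (below x n) (CodeSeq.decode c).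
    split=> [[y [py [m <-]]]|[y [m [py E]]]]; exists y.
      by exists m; rewrite /prefix_code CodeSeq.codeK.
    by split=> //; exists m; rewrite /prefix_code -E CodeSeq.decodeK.
  rewrite /derived_tree; have -> // : below x n = stage D n.
  by apply/seteqP; split=> r h /xE.
have Dl_in_tree : Dl 2 (fun e F => in_tree (F 0) (e 0) (e 1)).
  apply: Dl_exF; apply: Dl_and; first by apply: Dl_piece; td.
  by apply: Dl_exN; apply: Dl_prefix_code; td.
have [x0 x0E] := code_of_rel (tower_le D).
have x0_rel : tower_rel D (code_rel x0).
  have -> : code_rel x0 = tower_le D.
    by apply: funext => s; apply: funext => t; apply/propext.
  exact: tower_rel_tower_le (@derivative_mono C f) kT.
have Dl_in_tree3 := Dl_le (isT : 2 <= 3) Dl_in_tree.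
split.
  apply: (@eq_Sg _ (fun e F => exists x, tower_rel D (code_rel x) /\
    in_tree x (e 0) (e 1))).
    move=> e F; split=> [[x [hx]]|h]; first by move/in_treeE; exact.
    by exists x0; split=> //; apply/in_treeE.
  by apply: Sg_exF; apply: Sg_and; [exact: Dl_tower_rel.1|exact: Dl_in_tree3.1].
apply: (@eq_Sg _ (fun e F => exists x, tower_rel D (code_rel x) /\
  ~ in_tree x (e 0) (e 1))).
  move=> e F; split=> [[x [hx nx]] h|h]; first by apply: nx; apply/in_treeE.
  by exists x0; split=> // /(in_treeE _ _ _ x0_rel).
by apply: Sg_exF; apply: Sg_and; [exact: Dl_tower_rel.1|exact: Dl_in_tree3.2].
Qed.

End DerivativeDefinability.

Lemma Dl_sat n P : Dl n P ->
  (exists2 p, Sigma1 n p & forall e F, sat e F p <-> P (num_env e) (fun_env F)) /\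
  (exists2 p, Pi1 n p & forall e F, sat e F p <-> P (num_env e) (fun_env F)).
Proof.
move=> [/Sigma1_Sg[[p Sp hp] _] /Sigma1_Sg[_ [q Pq hq]]]; split.
  by exists p => // e F; rewrite satE.
by exists q => // e F; rewrite satE hq notK.
Qed.

Lemma lightface_Sigma11_closed_image (A : set baire) : lightface_Sigma1 1 A ->
  exists C : set baire, [/\ Dl 1 (fun _ F => C (F 0)),
    forall y, (forall m, exists2 y', C y' & agree m y y') -> C y &
    A = slice 0 @` C].
Proof.
case=> p /Sg_Sigma1/Sg1_proj_closed[Q [aQ cQ QE]] AE.
pose s (e : nat -> nat) (F : assignment) : nat -> nat := fun=> 0.
pose t (e : nat -> nat) (F : assignment) : assignment :=
  slice 1 (F 0) .: (slice 0 (F 0) .: (fun _ _ => 0)).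
have hs i : term_definable (fun e F => s e F i) by rewrite /s; td.
have ht i : fun_definable (fun e F => t e F i).
  by rewrite /t; case: i => [|[|i]] /=; td.
pose C : set baire := [set y | Q (fun=> 0) (slice 1 y .: (slice 0 y .: (fun _ _ => 0)))].
exists C; split.
- by apply: Dl_arith; exact: (Sg_sub (n := 0) hs ht aQ).
- move=> y h; apply: (closed_pred_sub hs ht cQ (e := fun=> 0) (F := fun=> y)) => m.
  by have [y' Cy' ag] := h m; exists (fun=> 0), (fun=> y'); split=> //; split.
have env0 : num_env [::] = fun=> 0 by apply: funext => i; rewrite /num_env nth_nil.
have fenv0 : fun_env [::] = fun _ _ => 0.
  by apply: funext => i; rewrite /fun_env nth_nil.
apply/seteqP; split=> [x|_ [y Cy <-]].
  rewrite AE /= satE env0 fun_env_cons fenv0 => /QE[z hz].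
  have [y hy] := slice_surj (x .: (fun=> z)).
  by exists y; rewrite /C /= hy// hy.
by rewrite AE /= satE env0 fun_env_cons fenv0; apply/QE; exists (slice 1 y).
Qed.

Unset Implicit Arguments.

Theorem theorem6p2 (A : set baire) (hA : lightface_Sigma1 1 A) :
  let I := effectively_sigma_compact_Delta1 3 A in
  let II := exists Y : set baire,
    [/\ Y `<=` A, homeomorphic_to_baire Y & relatively_closed A Y] in
  (I \/ II) /\ ~ (I /\ II).
Proof.
move=> I II; split; last first.
  move=> [[T [_ cT AE]] [Y [YA hY cY]]].
  by apply: (sigma_compact_no_closed_copy _ AE YA hY cY) => n; have [] := cT n.
have [C [defC closedC AE]] := lightface_Sigma11_closed_image hA.
have mod l : exists m, forall y y', agree m y y' -> agree l (slice 0 y) (slice 0 y').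
  exists (npair 0 l) => y y' h i il; apply: h.
  by rewrite /npair; nia.
have [kT|] := kernel_dichotomy closedC mod; last by rewrite -AE; right.
left; exists (derived_tree C (slice 0)).
have dT := Dl_derived_tree defC kT.
split; last by rewrite AE; exact: sigma_compact_decomposition.
  have [[p Sp hp] [q Pq hq]] := Dl_sat dT.
  split; [exists p|exists q] => // n; apply/seteqP; split=> u /=;
    by rewrite (hp, hq) /num_env /= CodeSeq.codeK.
move=> n; split; first exact/piece_tree_compact/derivative_stage.
have hs i : term_definable (fun e (_ : assignment) => (n .: e) i).
  by case: i => [|i] /=; td.
have ht i : fun_definable (fun _ (F : assignment) => F i) by td.
have [[p Sp hp] [q Pq hq]] := Dl_sat (Dl_sub hs ht dT).
split; [exists p|exists q] => //; apply/seteqP; split=> u /=;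
  by rewrite (hp, hq) /num_env /= CodeSeq.codeK.
Qed.
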